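(* For any reversible irreducible finite lazy Markov chain $(\Omega,P,\pi)$ and any $\epsilon\in(0,\tfrac14]$, the following inequalities hold: $$\text{(a)}\quad \mathrm{hit}_{1/2}(3\epsilon/2)-\lceil 2t_{\mathrm{rel}}|\log\epsilon|\rceil\le t_{\mathrm{mix}}(\epsilon)\le \mathrm{hit}_{1/2}(\epsilon/2)+\lceil t_{\mathrm{rel}}\log(4/\epsilon)\rceil,$$ $$\text{(b)}\quad \mathrm{hit}_{1/2}(1-\epsilon/2)-\lceil 2t_{\mathrm{rel}}|\log\epsilon|\rceil\le t_{\mathrm{mix}}(1-\epsilon)\le \mathrm{hit}_{1/2}(1-2\epsilon)+\lceil t_{\mathrm{rel}}\rceil,$$ $$\text{(c)}\quad \max\{\mathrm{hit}_{1-\epsilon/4}(5\epsilon/4),\,(t_{\mathrm{rel}}-1)|\log 2\epsilon|\}\le t_{\mathrm{mix}}(\epsilon)\le \mathrm{hit}_{1-\epsilon/4}(3\epsilon/4)+\left\lceil\tfrac{3t_{\mathrm{rel}}}{2}\log(4/\epsilon)\right\rceil .$$ Finally, if everywhere in (a)–(c) $t_{\mathrm{mix}}$ and $\mathrm{hit}$ are replaced by $t_{\mathrm{mix}}^{\mathrm{ct}}$ and $\mathrm{hit}^{\mathrm{ct}}$, respectively, then (a)–(c) still hold, and all ceiling signs can be omitted.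
   Context: A finite chain $(\Omega,P,\pi)$ has state space $\Omega$, transition matrix $P$, stationary distribution $\pi$; it is lazy if $P(x,x)\ge1/2$ for all $x$ and reversible if $\pi(x)P(x,y)=\pi(y)P(y,x)$. Chains have at least two states. The eigenvalues of $P$ are $1=\lambda_1>\lambda_2\ge\dots\ge\lambda_{|\Omega|}\ge 0$ and $t_{\mathrm{rel}}:=(1-\lambda_2)^{-1}$. Discrete time: $d(t):=\max_{x}\|P^t(x,\cdot)-\pi\|_{\mathrm{TV}}$ and $t_{\mathrm{mix}}(\epsilon):=\inf\{t\in\mathbb Z_{\ge0}: d(t)\le\epsilon\}$. With $T_A:=\inf\{t\ge0:X_t\in A\}$ and $\mathrm P_x$ the law of the chain $(X_t)$ started at $x$, let $p(\alpha,t):=\max_{x\in\Omega}\max_{A\subset\Omega:\,\pi(A)\ge\alpha}\mathrm P_x[T_A>t]$ and $\mathrm{hit}_\alpha(\epsilon):=\min\{t\in\mathbb Z_{\ge0}:p(\alpha,t)\le\epsilon\}$. Continuous time: $(X_t^{\mathrm{ct}})_{t\ge0}$ is the continuous-time chain with heat kernel $H_t(x,y)=\sum_{k=0}^\infty \frac{e^{-t}t^k}{k!}P^k(x,y)$, and $\mathrm H_x$ is its law when started at $x$. Then $d_{\mathrm{ct}}(t):=\max_x\|H_t(x,\cdot)-\pi\|_{\mathrm{TV}}$, $t_{\mathrm{mix}}^{\mathrm{ct}}(\epsilon):=\inf\{t\in[0,\infty):d_{\mathrm{ct}}(t)\le\epsilon\}$, $T_A^{\mathrm{ct}}:=\inf\{t\ge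 0:X^{\mathrm{ct}}_t\in A\}$, $p_x^{\mathrm{ct}}(\alpha,t):=\max_{A:\,\pi(A)\ge\alpha}\mathrm H_x[T_A^{\mathrm{ct}}>t]$ and $\mathrm{hit}_\alpha^{\mathrm{ct}}(\epsilon):=\min\{t\in[0,\infty):p_x^{\mathrm{ct}}(\alpha,t)\le\epsilon\text{ for all }x\in\Omega\}$. In the continuous-time version $t_{\mathrm{rel}}$ is still $(1-\lambda_2)^{-1}$. $\log$ is the natural logarithm. *)

(* Defs.v *)
From HB Require Import structures.
From mathcomp Require Import all_boot all_order all_algebra.
From mathcomp Require Import all_classical all_reals all_analysis.
Set Implicit Arguments.
Unset Strict Implicit.
Unset Printing Implicit Defensive.
Import Order.TTheory GRing.Theory Num.Theory.
Import numFieldNormedType.Exports.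
Local Open Scope classical_set_scope.
Local Open Scope ring_scope.

(* The state space is 'I_n; the entry P x y is the transition probability from
   x to y, and distributions are row vectors. *)
Section Chains.
Context {R : realType} {n : nat}.
Implicit Types (P : 'M[R]_n) (pi mu nu : 'rV[R]_n) (A : {set 'I_n}).

Definition distribution_vec mu :=
  (forall x, 0 <= mu 0 x) /\ \sum_x mu 0 x = 1.

Definition stochastic P := forall x, distribution_vec (row x P).

Definition stationary P pi := distribution_vec pi /\ pi *m P = pi.

Definition irreducible P := forall x y, exists t : nat, 0 < (P ^+ t) x y.

Definition reversible P pi :=
  forall x y, pi 0 x * P x y = pi 0 y * P y x.

Definition lazy P := forall x, 2^-1 <= P x x.

(* The eigenvalues with multiplicity in nonincreasing order. For a reversible
   irreducible chain P is similar to a symmetric real matrix, so such a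
   sequence exists, and it is unique. *)
Definition eigenvalues P : seq R :=
  xget [::] [set s | sorted (fun a b : R => b <= a) s /\
                     char_poly P = \prod_(a <- s) ('X - a%:P)].

Definition lambda2 P : R := nth 0 (eigenvalues P) 1.

Definition trel P : R := (1 - lambda2 P)^-1.

Definition tv_dist mu nu : R := 2^-1 * \sum_x `|mu 0 x - nu 0 x|.

Definition mass pi A : R := \sum_(x in A) pi 0 x.

Definition heat_kernel P (t : R) : 'M[R]_n :=
  \matrix_(x, y)
    limn (series (fun k => expR (- t) * t ^+ k / k`!%:R * (P ^+ k) x y)).

Definition dist_mix P pi (t : nat) : R :=
  \big[Num.max/0]_x tv_dist (row x (P ^+ t)) pi.

(* For the chains considered below, all the sets whose [inf] is taken are
   nonempty and bounded below by 0. *)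
Definition tmix P pi (eps : R) : R :=
  inf [set t%:R | t in [set t : nat | dist_mix P pi t <= eps]].

Definition dist_mix_ct P pi (t : R) : R :=
  \big[Num.max/0]_x tv_dist (row x (heat_kernel P t)) pi.

Definition tmix_ct P pi (eps : R) : R :=
  inf [set t | 0 <= t /\ dist_mix_ct P pi t <= eps].

Context {d : measure_display} {T : measurableType d}.
Implicit Types (Pr : 'I_n -> probability T R).

(* Under [Pr x], X is a Markov chain with transition matrix P started at x. *)
Definition markov_chain P Pr (X : nat -> T -> 'I_n) :=
  (forall t y, measurable (X t @^-1` [set y])) /\
  (forall x (m : nat) (y : nat -> 'I_n),
    Pr x [set w | forall i, (i <= m)%N -> X i w = y i] =
    ((y 0%N == x)%:R * \prod_(i < m) P (y i) (y i.+1))%:E).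

(* Under [Pr x], X is a right-continuous continuous-time Markov chain with
   transition function [heat_kernel P] started at x; only the times t >= 0 are
   meaningful. *)
Definition markov_chain_ct P Pr (X : R -> T -> 'I_n) :=
  [/\ forall (t : R) y, 0 <= t -> measurable (X t @^-1` [set y]),
      forall w (t : R), 0 <= t -> \forall s \near t^'+, X s w = X t w &
      forall x (m : nat) (t : nat -> R) (y : nat -> 'I_n),
        t 0%N = 0 -> (forall i, (i < m)%N -> t i <= t i.+1) ->
        Pr x [set w | forall i, (i <= m)%N -> X (t i) w = y i] =
        ((y 0%N == x)%:R *
          \prod_(i < m) heat_kernel P (t i.+1 - t i) (y i) (y i.+1))%:E].

Definition hitting_time (X : nat -> T -> 'I_n) A (w : T) : \bar R :=
  ereal_inf [set (t%:R)%:E | t in [set t : nat | X t w \in A]].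

Definition p_hit pi Pr (X : nat -> T -> 'I_n) (alpha : R) (t : nat) : R :=
  \big[Num.max/0]_x \big[Num.max/0]_(A : {set 'I_n} | alpha <= mass pi A)
    fine (Pr x [set w | ((t%:R)%:E < hitting_time X A w)%E]).

Definition hit pi Pr (X : nat -> T -> 'I_n) (alpha eps : R) : R :=
  inf [set t%:R | t in [set t : nat | p_hit pi Pr X alpha t <= eps]].

Definition hitting_time_ct (X : R -> T -> 'I_n) A (w : T) : \bar R :=
  ereal_inf [set t%:E | t in [set t : R | 0 <= t /\ X t w \in A]].

Definition p_hit_ct pi Pr (X : R -> T -> 'I_n) (x : 'I_n) (alpha t : R) : R :=
  \big[Num.max/0]_(A : {set 'I_n} | alpha <= mass pi A)
    fine (Pr x [set w | (t%:E < hitting_time_ct X A w)%E]).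

Definition hit_ct pi Pr (X : R -> T -> 'I_n) (alpha eps : R) : R :=
  inf [set t | 0 <= t /\ forall x, p_hit_ct pi Pr X x alpha t <= eps].

End Chains.

Definition ceilr {R : realType} (a : R) : R := (Num.ceil a)%:~R.

(* Main.v *)
Require Import Defs.
From HB Require Import structures.
From mathcomp Require Import all_boot all_order all_algebra.
From mathcomp Require Import sesquilinear spectral.
From mathcomp.real_closed Require complex.
From mathcomp Require Import all_classical all_reals all_analysis.
From mathcomp Require Import ring lra.
Set Implicit Arguments.
Unset Strict Implicit.
Unset Printing Implicit Defensive.
Import Order.TTheory GRing.Theory Num.Theory.
Import numFieldNormedType.Exports.
Local Open Scope classical_set_scope.
Local Open Scope ring_scope.

(* Upper bounds on t_mix: fix a test set A and let f be the deviation
   pi(A) - P^t(., A). By Stein's maximal inequality, outside a set of pi-mass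
   at most 6/m^2 all the iterates P^k f stay below m |f|_2, where |f|_2 decays
   like exp(-t / t_rel). Once the chain has hit this good set, the deviation at
   any time at least t later is at most m |f|_2, so a bound on the hitting
   probability becomes a bound on the total variation distance. The maximal
   inequality is proved by writing P^k f as an ergodic average, controlled by
   the maximal ergodic lemma, plus a remainder controlled by a square function.

   Lower bounds on t_mix: run the chain until it is mixed, then use that from
   stationarity a set A of mass at least 1/2 is avoided for s steps with
   probability at most exp(-s / (2 t_rel)) / 2, since killing on A lowers the
   top of the spectrum. The bound by t_rel - 1 tests d(t) on an eigenfunction
   of lambda_2.

   In continuous time the chain observed along a dyadic grid of mesh delta is a
   discrete chain with kernel H_delta, which is reversible and positive
   semidefinite, and by right-continuity its avoidance probabilities decrease
   to those of the continuous chain. *)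

(** [eigenvalues] is a chosen root sequence of [char_poly P] and [heat_kernel] is an entrywise
    series, so an explicit diagonalization is needed before either can be related to quadratic forms
    in L^2(pi). The maximal inequality and the avoidance bounds are proved for any reversible,
    positive semidefinite stochastic kernel [Q], since they serve both P and H_delta.
    Semidefiniteness, which laziness supplies for P, makes j -> <Q^j f, f> convex and lets each step
    of the killed chain contract by the same factor. For a test set of mass a, |f|_2^2 is at most
    exp(-2t / t_rel) a (1 - a). Keeping the factor a (1 - a) is what makes the bounds uniform in the
    test set: missing the good set costs at most a, hitting it at most m |f|_2, and AM-GM balances
    the two. The constant 6 is 4 for the averages plus 2 for the remainder; good sets of mass 1/2
    and 1 - eps/4 then require m^2 = 12 and m^2 = 24/eps, and the waiting times in the upper bounds
    make m^2 exp(-2t / t_rel) small enough. *)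

(** * Diagonalization of real symmetric matrices *)

Section SymmetricDiag.
Import complex.

(** Over the complex numbers S is Hermitian, hence similar to a diagonal matrix with real entries,
    and real matrices similar over C are similar over R. The descent keeps only the invertibility of
    [V], not its orthogonality. *)
Lemma symmetric_diag (R : rcfType) n (S : 'M[R]_n) : S^T = S ->
  exists V : 'M[R]_n, exists2 d : 'rV[R]_n,
    V \in unitmx & V *m S = diag_mx d *m V.
Proof.
move=> Ssym; pose toC : {rmorphism R -> complex R} := real_complex R.
pose SC := map_mx toC S.
have toC_real x : toC x \is Num.real.
  by apply/CrealP; exact: complex.conjc_real.
have realP (z : complex R) : z \is Num.real -> z = toC (complex.Re z).
  by move=> /CrealP; case: z => a b [] Nb; have -> : b = 0 by lra.
have SCreal : SC \is a realmx by apply/mxOverP=> i j; rewrite mxE.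
have SCsym : SC \is symmetricmx.
  by apply/is_hermitianmxP; apply/matrixP => i j; rewrite expr0 scale1r !mxE -[in LHS]Ssym mxE.
have SCherm := realsym_hermsym SCsym SCreal.
have /orthomx_spectralP SCE := hermitian_normalmx SCherm.
have dreal := hermitian_spectral_diag_real SCherm.
set U := spectralmx SC in SCE; set dC := spectral_diag SC in SCE dreal.
have Uunit : U \in unitmx by exact: spectral_unit.
have : similar_in unitmx SC (diag_mx dC).
  exists U => //; apply/similarP => //.
  by rewrite [in LHS]SCE !mulmxA mulmxV// mul1mx.
move=> /real_similar/(_ SCreal).
case.
  apply/mxOverP => i j; rewrite mxE; case: eqP => _; rewrite ?mulr1n ?mulr0n//.
  by have /mxOverP := dreal; apply.
move=> Q /andP[Qreal Qunit] /(similarP Qunit) QE.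
have mapK m p (A : 'M[complex R]_(m, p)) : A \is a realmx ->
    map_mx toC (map_mx (@complex.Re R) A) = A.
  move=> /mxOverP Ar; apply/matrixP => i j; rewrite !mxE.
  by rewrite -realP.
exists (map_mx (@complex.Re R) Q); exists (map_mx (@complex.Re R) dC).
  by rewrite -(map_unitmx toC) mapK.
apply: (map_mx_inj (f := toC)); rewrite !map_mxM mapK// map_diag_mx mapK//.
Qed.

End SymmetricDiag.

(** * The inner product of L^2(pi) and reversibility as self-adjointness *)

Section WeightedInnerProduct.
Context {R : realType} {n : nat}.
Implicit Types (P Q : 'M[R]_n) (pi : 'rV[R]_n) (f g h : 'cV[R]_n).

Definition ip pi f g : R := \sum_x pi 0 x * (f x 0 * g x 0).

Definition mean pi f : R := \sum_x pi 0 x * f x 0.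

Lemma ipC pi f g : ip pi f g = ip pi g f.
Proof. by apply: eq_bigr => x _; rewrite [f x 0 * _]mulrC. Qed.

Lemma ipDl pi f g h : ip pi (f + g) h = ip pi f h + ip pi g h.
Proof. by rewrite -big_split; apply: eq_bigr => x _; rewrite !mxE /=; ring. Qed.

Lemma ipZl pi a f g : ip pi (a *: f) g = a * ip pi f g.
Proof. by rewrite mulr_sumr; apply: eq_bigr => x _; rewrite !mxE; ring. Qed.

Lemma ipBl pi f g h : ip pi (f - g) h = ip pi f h - ip pi g h.
Proof. by rewrite -scaleN1r ipDl ipZl mulN1r. Qed.

Lemma ipZr pi a f g : ip pi f (a *: g) = a * ip pi f g.
Proof. by rewrite ipC ipZl ipC. Qed.

Lemma ipBr pi f g h : ip pi f (g - h) = ip pi f g - ip pi f h.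
Proof. by rewrite ipC ipBl !(ipC _ f). Qed.

Lemma ip_one pi f : ip pi f (const_mx 1) = mean pi f.
Proof. by apply: eq_bigr => x _; rewrite !mxE mulr1. Qed.

Lemma ip_ge0 pi f : (forall x, 0 <= pi 0 x) -> 0 <= ip pi f f.
Proof. by move=> pi0; apply: sumr_ge0 => x _; rewrite mulr_ge0// -expr2 sqr_ge0. Qed.

Lemma ip_eq0 pi f : (forall x, 0 < pi 0 x) -> ip pi f f = 0 -> f = 0.
Proof.
move=> pi0 /eqP; rewrite psumr_eq0; last first.
  by move=> x _; apply: mulr_ge0; [exact: ltW | rewrite -expr2 sqr_ge0].
move=> /allP f0; apply/matrixP => x j; rewrite ord1 mxE.
have := f0 x (mem_index_enum x); rewrite implyTb mulf_eq0 gt_eqF//=.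
by rewrite mulf_eq0 orbb => /eqP.
Qed.

Lemma reversible_ip P pi f g : reversible P pi ->
  ip pi (P *m f) g = ip pi f (P *m g).
Proof.
move=> revP; rewrite /ip.
transitivity (\sum_x \sum_y pi 0 x * P x y * f y 0 * g x 0).
  by apply: eq_bigr => x _; rewrite mxE mulr_suml mulr_sumr; apply: eq_bigr => y _; ring.
rewrite exchange_big; apply: eq_bigr => x _.
rewrite mxE !mulr_sumr; apply: eq_bigr => y _; rewrite /= (revP y x); ring.
Qed.

Lemma reversible_mul P Q pi : reversible P pi -> reversible Q pi ->
  P *m Q = Q *m P -> reversible (P *m Q) pi.
Proof.
move=> revP revQ PQ x y; rewrite {1}PQ !mxE !mulr_sumr; apply: eq_bigr => z _.
by rewrite mulrA revQ -mulrA (mulrC (Q z x)) mulrA revP -mulrA.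
Qed.

Lemma reversible1 pi : reversible (1 : 'M[R]_n) pi.
Proof. by move=> x y; rewrite !mxE eq_sym; case: eqP => [->|_]//; rewrite !mulr0. Qed.

Lemma reversibleX P pi k : reversible P pi -> reversible (P ^+ k) pi.
Proof.
move=> revP; elim: k => [|k IH]; first exact: reversible1.
rewrite exprS; apply: reversible_mul => //.
by change (P * P ^+ k = P ^+ k * P); rewrite -exprS -exprSr.
Qed.

End WeightedInnerProduct.

(** * Stochastic matrices: quadratic form bounds, laziness, harmonic functions *)

Section Stochastic.
Context {R : realType} {n : nat}.
Implicit Types (P Q : 'M[R]_n) (pi : 'rV[R]_n) (f g h : 'cV[R]_n).

Lemma stochastic_ge0 P x y : stochastic P -> 0 <= P x y.
Proof. by case/(_ x) => /(_ y); rewrite mxE. Qed.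

Lemma stochastic_sum P x : stochastic P -> \sum_y P x y = 1.
Proof. by case/(_ x) => _ <-; apply: eq_bigr => y _; rewrite mxE. Qed.

Lemma stochasticP P : (forall x y, 0 <= P x y) -> (forall x, \sum_y P x y = 1) ->
  stochastic P.
Proof.
move=> P0 P1 x; split=> [y|]; first by rewrite mxE.
by rewrite -[RHS](P1 x); apply: eq_bigr => y _; rewrite mxE.
Qed.

Lemma stochastic_one P : stochastic P -> P *m const_mx 1 = const_mx 1 :> 'cV_n.
Proof.
move=> sP; apply/matrixP => x j; rewrite !mxE -[RHS](stochastic_sum x sP).
by apply: eq_bigr => y _; rewrite mxE mulr1.
Qed.

Lemma stochastic1 : stochastic (1 : 'M[R]_n).
Proof.
apply: stochasticP => [x y|x]; first by rewrite mxE ler0n.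
rewrite (bigD1 x)//= big1 ?addr0 ?mxE ?eqxx// => y yx.
by rewrite mxE eq_sym (negbTE yx).
Qed.

Lemma stochastic_mul P Q : stochastic P -> stochastic Q -> stochastic (P *m Q).
Proof.
move=> sP sQ; apply: stochasticP => [x y|x].
  by rewrite mxE; apply: sumr_ge0 => z _; rewrite mulr_ge0 ?stochastic_ge0.
under eq_bigr do rewrite mxE.
rewrite exchange_big /= -[RHS](stochastic_sum x sP); apply: eq_bigr => z _.
by rewrite -mulr_sumr stochastic_sum// mulr1.
Qed.

Lemma stochasticX P k : stochastic P -> stochastic (P ^+ k).
Proof.
move=> sP; elim: k => [|k IH]; first exact: stochastic1.
by rewrite exprS; exact: stochastic_mul.
Qed.

Lemma stochastic_le P f g x : stochastic P -> (forall y, f y 0 <= g y 0) ->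
  (P *m f) x 0 <= (P *m g) x 0.
Proof.
by move=> sP fg; rewrite !mxE; apply: ler_sum => y _; rewrite ler_wpM2l ?stochastic_ge0.
Qed.

Lemma stochastic_norm P f x : stochastic P ->
  `|(P *m f) x 0| <= (P *m map_mx Num.norm f) x 0.
Proof.
move=> sP; rewrite !mxE (le_trans (ler_norm_sum _ _ _))//.
by apply: ler_sum => y _; rewrite mxE normrM ger0_norm ?stochastic_ge0.
Qed.

Lemma mean_mul P pi f : stochastic P -> reversible P pi ->
  mean pi (P *m f) = mean pi f.
Proof. by move=> sP rP; rewrite -!ip_one reversible_ip// stochastic_one. Qed.

(* Expand [pi(x) P(x,y) (f x + s f y)^2 >= 0] for s = 1 and s = -1. *)
Lemma ip_mul_bound P pi f : (forall x, 0 <= pi 0 x) -> stochastic P ->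
  reversible P pi -> - ip pi f f <= ip pi (P *m f) f <= ip pi f f.
Proof.
move=> pi0 sP rP.
have E1 : ip pi (P *m f) f = \sum_x \sum_y pi 0 x * P x y * (f x 0 * f y 0).
  by apply: eq_bigr => x _; rewrite mxE mulr_suml mulr_sumr; apply: eq_bigr => y _; ring.
have E2 : ip pi f f = \sum_x \sum_y pi 0 x * P x y * (f x 0) ^+ 2.
  apply: eq_bigr => x _; rewrite -mulr_suml -mulr_sumr stochastic_sum//; ring.
have E3 : ip pi f f = \sum_x \sum_y pi 0 x * P x y * (f y 0) ^+ 2.
  rewrite E2 exchange_big; apply: eq_bigr => x _; apply: eq_bigr => y _ /=.
  by rewrite rP.
have P0 s : 0 <= \sum_x \sum_y pi 0 x * P x y * (f x 0 + s * f y 0) ^+ 2.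
  apply: sumr_ge0 => x _; apply: sumr_ge0 => y _.
  by rewrite mulr_ge0 ?sqr_ge0// mulr_ge0// stochastic_ge0.
have E s : \sum_x \sum_y pi 0 x * P x y * (f x 0 + s * f y 0) ^+ 2 =
    ip pi f f + s ^+ 2 * ip pi f f + 2 * s * ip pi (P *m f) f.
  rewrite {1}E2 E3 E1 !mulr_sumr -!big_split; apply: eq_bigr => x _.
  rewrite !mulr_sumr -!big_split; apply: eq_bigr => y _ /=; ring.
have := P0 1; have := P0 (-1); rewrite !E; lra.
Qed.

(** Laziness makes P' = 2P - 1 a stochastic matrix, again reversible, so <P' f, f> >= - <f, f>; P is
    the average of P' and the identity. *)
Lemma lazy_psd P pi f : (forall x, 0 <= pi 0 x) -> stochastic P ->
  reversible P pi -> lazy P -> 0 <= ip pi (P *m f) f.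
Proof.
move=> pi0 sP rP lP; pose P' : 'M[R]_n := 2 *: P - 1%:M.
have sP' : stochastic P'.
  apply: stochasticP => [x y|x].
    rewrite !mxE; case: eqP => [<-|_]; last first.
      by rewrite subr0 mulr_ge0// stochastic_ge0.
    by have := lP x; rewrite /=; lra.
  under eq_bigr do rewrite !mxE.
  rewrite sumrB -mulr_sumr stochastic_sum//.
  rewrite (bigD1 x)//= big1 ?eqxx ?addr0/=; first lra.
  by move=> y yx; rewrite eq_sym (negbTE yx).
have rP' : reversible P' pi.
  move=> x y; rewrite !mxE !mulrBr; congr (_ - _).
    by rewrite mulrCA rP mulrCA.
  by have := reversible1 pi x y; rewrite !mxE.
have := ip_mul_bound f pi0 sP' rP' => /andP[+ _].
by rewrite mulmxBl mul1mx -scalemxAl ipBl ipZl; lra.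
Qed.

Lemma irreducible_pi_gt0 P pi x : stochastic P -> stationary P pi ->
  irreducible P -> 0 < pi 0 x.
Proof.
move=> sP [[pi0 pi1] piP] iP.
have piX t : pi *m P ^+ t = pi.
  elim: t => [|t IH]; first by rewrite expr0 mulmx1.
  by rewrite exprS -[P * _]/(P *m _) mulmxA piP.
have [y piy] : exists y, 0 < pi 0 y.
  apply/existsP; apply: contraT; rewrite negb_exists => /forallP pile.
  suff : (1 : R) <= 0 by rewrite ler10.
  by rewrite -pi1; apply: sumr_le0 => y _; rewrite leNgt.
have [t Pt] := iP y x.
have <- : (pi *m P ^+ t) 0 x = pi 0 x by rewrite piX.
rewrite mxE (bigD1 y)//= ltr_pwDl ?mulr_gt0//.
by apply: sumr_ge0 => z _; rewrite mulr_ge0// stochastic_ge0//; exact: stochasticX.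
Qed.

(* At a maximum of h the average of h over P^t equals h, which forces h to be
   constant on the states reachable from it. *)
Lemma harmonic_const P h : stochastic P -> irreducible P -> P *m h = h ->
  forall x y, h x 0 = h y 0.
Proof.
move=> sP iP hP.
have hX t : P ^+ t *m h = h.
  elim: t => [|t IH]; first by rewrite expr0 mul1mx.
  by rewrite exprSr -[_ * P]/(_ *m P) -mulmxA hP.
move=> x0; have [x _ hx] := arg_maxP (fun x => h x 0) (isT : xpredT x0).
suff hE y : h y 0 = h x 0 by move=> y; rewrite !hE.
have [t Pt] := iP x y.
have sPt := stochasticX t sP.
have : \sum_z (P ^+ t) x z * (h x 0 - h z 0) = 0.
  under eq_bigr do rewrite mulrBr.
  rewrite sumrB -mulr_suml stochastic_sum// mul1r.
  have : (P ^+ t *m h) x 0 = h x 0 by rewrite hX.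
  by rewrite mxE => ->; rewrite subrr.
move/eqP; rewrite psumr_eq0 => [|z _]; last first.
  by rewrite mulr_ge0 ?stochastic_ge0// subr_ge0; exact: hx.
move=> /allP /(_ y (mem_index_enum y)); rewrite implyTb mulf_eq0 (gt_eqF Pt)/=.
by rewrite subr_eq0 => /eqP.
Qed.

End Stochastic.

(** * Functional calculus of a reversible matrix *)

Section FunctionalCalculus.
Context {R : realType} {n : nat}.
Implicit Types (P Q : 'M[R]_n) (pi : 'rV[R]_n) (f g h : 'cV[R]_n).

(** Reversibility says that conjugation by the diagonal matrix of square roots of pi turns P into a
    symmetric matrix. *)
Lemma reversible_diag P pi : (forall x, 0 < pi 0 x) -> reversible P pi ->
  exists V : 'M[R]_n, exists2 d : 'rV[R]_n,
    V \in unitmx & V *m P = diag_mx d *m V.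
Proof.
move=> pi0 rP; pose s x : R := Num.sqrt (pi 0 x).
have s0 x : s x != 0 by rewrite gt_eqF// sqrtr_gt0.
have s2 x : s x ^+ 2 = pi 0 x by rewrite sqr_sqrtr// ltW.
pose D : 'M[R]_n := diag_mx (\row_x s x).
pose S : 'M[R]_n := \matrix_(x, y) (s x * P x y / s y).
have Dunit : D \in unitmx.
  rewrite unitmxE det_diag unitfE; apply/prodf_neq0 => x _; by rewrite mxE.
have DS : D *m P = S *m D.
  apply/matrixP => x y; rewrite mul_diag_mx mul_mx_diag !mxE.
  by rewrite divfK.
have [|V [d Vunit VS]] := @symmetric_diag R n S.
  apply/matrixP => x y; rewrite !mxE; apply: (mulIf (s0 x)); rewrite divfK//.
  apply: (mulIf (s0 y)).
  rewrite -[RHS]mulrA [s x * s y]mulrC [RHS]mulrA divfK//.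
  by rewrite mulrAC -expr2 s2 -rP -s2; ring.
exists (V *m D); exists d; first by rewrite unitmx_mul Vunit.
by rewrite -mulmxA DS mulmxA VS mulmxA.
Qed.

Variables (P V : 'M[R]_n) (d : 'rV[R]_n).
Hypotheses (Vunit : V \in unitmx) (VP : V *m P = diag_mx d *m V).

(** This is phi(P). Powers, heat kernels, spectral projections and square roots of P are all
    instances, so identities between them reduce to identities on the eigenvalues. *)
Definition fc (phi : R -> R) : 'M[R]_n :=
  invmx V *m diag_mx (map_mx phi d) *m V.

Lemma fc_ext phi psi : (forall i, phi (d 0 i) = psi (d 0 i)) -> fc phi = fc psi.
Proof.
move=> E; rewrite /fc; congr (_ *m diag_mx _ *m _).
by apply/matrixP => i j; rewrite !mxE !ord1 E.
Qed.

Lemma fc_mul phi psi : fc phi *m fc psi = fc (fun z => phi z * psi z).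
Proof.
rewrite /fc !mulmxA; congr (_ *m _).
rewrite -(mulmxA _ V) mulmxV// mulmx1 -mulmxA mulmx_diag.
by congr (_ *m diag_mx _); apply/matrixP => i j; rewrite !mxE !ord1.
Qed.

Lemma fc_id : fc id = P.
Proof. by rewrite /fc map_mx_id// -mulmxA -VP mulKmx. Qed.

Lemma fc_cst c : fc (fun=> c) = c%:M.
Proof.
rewrite /fc; have -> : diag_mx (map_mx (fun=> c) d) = c%:M.
  by apply/matrixP => i j; rewrite !mxE.
by rewrite mul_mx_scalar -scalemxAl mulVmx// scalemx1.
Qed.

Lemma fcX k : fc (fun z => z ^+ k) = P ^+ k.
Proof.
elim: k => [|k IH]; first by rewrite expr0; exact: fc_cst.
rewrite exprS -IH -{1}fc_id -[_ * fc _]/(_ *m fc _) fc_mul.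
by apply: fc_ext => i; rewrite exprS.
Qed.

Lemma fc_add phi psi : fc phi + fc psi = fc (fun z => phi z + psi z).
Proof.
rewrite /fc -mulmxDl -mulmxDr -raddfD; congr (_ *m diag_mx _ *m _).
by apply/matrixP => i j; rewrite !mxE.
Qed.

Lemma fc_eigen phi lam f : P *m f = lam *: f -> fc phi *m f = phi lam *: f.
Proof.
move=> Pf.
have E i : d 0 i * (V *m f) i 0 = lam * (V *m f) i 0.
  have /matrixP/(_ i 0) : diag_mx d *m (V *m f) = lam *: (V *m f).
    by rewrite mulmxA -VP -mulmxA Pf scalemxAr.
  by rewrite mul_diag_mx !mxE.
rewrite /fc -!mulmxA.
have -> : diag_mx (map_mx phi d) *m (V *m f) = phi lam *: (V *m f).
  apply/matrixP => i j; rewrite mul_diag_mx ord1 !mxE.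
  have /eqP := E i; rewrite -subr_eq0 -mulrBl mulf_eq0 subr_eq0 mxE.
  by case/orP => /eqP ->//; rewrite !mulr0.
by rewrite -scalemxAr mulKmx.
Qed.

(** With D = diag(pi), reversibility of Q reads D Q = Q^T D. As [V] need not be orthogonal, the
    proof uses the Gram matrix [M] of the eigenbasis: it commutes with diag(d), so its entries
    vanish between distinct eigenvalues, so it commutes with diag(phi(d)). *)
Lemma fc_reversible pi phi : reversible P pi -> reversible (fc phi) pi.
Proof.
move=> rP; pose D : 'M[R]_n := diag_mx pi; pose W := invmx V.
have revE Q : reversible Q pi <-> D *m Q = Q^T *m D.
  split=> [rQ|E x y].
    by apply/matrixP => x y; rewrite mul_diag_mx mul_mx_diag !mxE mulrC [RHS]mulrC rQ mulrC.
  by have /matrixP/(_ x y) := E; rewrite mul_diag_mx mul_mx_diag !mxE [in RHS]mulrC.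
have DP := (revE _).1 rP; apply/revE.
pose M := W^T *m D *m W.
have PW : P *m W = W *m diag_mx d.
  by rewrite /W -[P](mulKmx Vunit) VP -!mulmxA mulmxV// mulmx1.
have WP : W^T *m P^T = diag_mx d *m W^T by rewrite -trmx_mul PW trmx_mul tr_diag_mx.
have Md : M *m diag_mx d = diag_mx d *m M.
  by rewrite /M -mulmxA -PW mulmxA -(mulmxA _ D) DP !mulmxA WP.
have Mphi (N : 'M[R]_n) : N *m diag_mx d = diag_mx d *m N ->
    N *m diag_mx (map_mx phi d) = diag_mx (map_mx phi d) *m N.
  move=> Nd; apply/matrixP => i j; have /matrixP/(_ i j) := Nd.
  rewrite !mul_diag_mx !mul_mx_diag !mxE => E.
  have /eqP : N i j * (d 0 j - d 0 i) = 0 by rewrite mulrBr E; ring.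
  by rewrite mulf_eq0 subr_eq0 => /orP[/eqP ->|/eqP ->]; rewrite ?mul0r ?mulr0// mulrC.
have VW : V^T *m W^T = 1%:M by rewrite -trmx_mul mulVmx// trmx1.
have WV : W *m V = 1%:M by rewrite mulVmx.
transitivity (V^T *m (M *m diag_mx (map_mx phi d)) *m V).
  by rewrite /M /fc !mulmxA VW mul1mx.
rewrite (Mphi _ Md) /M /fc !trmx_mul tr_diag_mx !mulmxA.
by rewrite -[in LHS](mulmxA _ W V) WV mulmx1.
Qed.

End FunctionalCalculus.

(** * Identification of [lambda2] and the spectral gap inequality *)

Section SecondEigenvalue.
Context {R : realType} {n : nat}.
Variables (P : 'M[R]_n) (pi : 'rV[R]_n).
Hypotheses (n_ge2 : (2 <= n)%N) (sP : stochastic P) (statP : stationary P pi)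
  (iP : irreducible P) (rP : reversible P pi) (lP : lazy P).
Variables (V : 'M[R]_n) (d : 'rV[R]_n).
Hypotheses (Vunit : V \in unitmx) (VP : V *m P = diag_mx d *m V).

Let pi_gt0 x : 0 < pi 0 x. Proof. exact: irreducible_pi_gt0 sP statP iP. Qed.
Let pi_ge0 x : 0 <= pi 0 x. Proof. exact: ltW. Qed.
Let pi1 : \sum_x pi 0 x = 1. Proof. by case: statP => -[]. Qed.

Let w i : 'cV[R]_n := col i (invmx V).

Let Pw i : P *m w i = d 0 i *: w i.
Proof.
have E : P *m invmx V = invmx V *m diag_mx d.
  by rewrite -[P](mulKmx Vunit) VP -!mulmxA mulmxV// mulmx1.
rewrite /w [in LHS]colE mulmxA E -colE; apply/matrixP => x j.
by rewrite [LHS]mxE mul_mx_diag !mxE mulrC.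
Qed.

Let Vw i : V *m w i = delta_mx i 0.
Proof. by rewrite /w colE mulmxA mulmxV// mul1mx. Qed.

Let w_neq0 i : w i != 0.
Proof.
apply/eqP => w0; have /matrixP/(_ i 0) := Vw i.
by rewrite w0 mulmx0 !mxE !eqxx => /esym/eqP; rewrite oner_eq0.
Qed.

Lemma eigen_bound (f : 'cV[R]_n) lam : P *m f = lam *: f -> f != 0 -> 0 <= lam <= 1.
Proof.
move=> Pf f0.
have ff : 0 < ip pi f f.
  rewrite lt_neqAle ip_ge0// andbT eq_sym; apply: contra f0 => /eqP/ip_eq0->//.
have := ip_mul_bound f pi_ge0 sP rP => /andP[_].
have := lazy_psd f pi_ge0 sP rP lP.
rewrite Pf ipZl => h1 h2; rewrite -(pmulr_lge0 _ ff) h1/=.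
by rewrite -(ler_pM2r ff) mul1r.
Qed.

Let d_bound i : 0 <= d 0 i <= 1.
Proof. exact: eigen_bound (Pw i) (w_neq0 i). Qed.

Let ex_one : exists i, d 0 i = 1.
Proof.
have one0 : V *m const_mx 1 != 0 :> 'cV[R]_n.
  apply/eqP => /(congr1 (mulmx (invmx V))); rewrite mulKmx// mulmx0.
  move=> /matrixP/(_ (Ordinal n_ge2) 0); rewrite !mxE => /eqP; by rewrite oner_eq0.
have [i Hi] : exists i, (V *m (const_mx 1 : 'cV[R]_n)) i 0 != 0.
  apply/existsP; apply: contraT; rewrite negb_exists => /forallP V0.
  case/eqP: one0; apply/matrixP => i j; rewrite ord1 [RHS]mxE.
  by have := V0 i; rewrite negbK => /eqP.
exists i; apply: (mulIf Hi); rewrite mul1r.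
have /matrixP/(_ i 0) : diag_mx d *m (V *m (const_mx 1 : 'cV[R]_n)) = V *m const_mx 1.
  by rewrite mulmxA -VP -mulmxA stochastic_one.
by rewrite mul_diag_mx mxE.
Qed.

(** Eigenvectors for 1 are harmonic, hence constant, hence proportional, whereas distinct columns of
    [invmx V] are independent. *)
Let one_uniq i j : d 0 i = 1 -> d 0 j = 1 -> i = j.
Proof.
move=> di dj; apply/eqP; apply: contraT => ij.
have hi : P *m w i = w i by rewrite Pw di scale1r.
have hj : P *m w j = w j by rewrite Pw dj scale1r.
pose z : 'I_n := i.
have := harmonic_const sP iP hi => /(_ _ z) ci.
have := harmonic_const sP iP hj => /(_ _ z) cj.
have E : (w j z 0) *: w i = (w i z 0) *: w j.
  by apply/matrixP => x k; rewrite ord1 [LHS]mxE [RHS]mxE ci cj mulrC.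
have /matrixP/(_ i 0) := congr1 (mulmx V) E.
rewrite -!scalemxAr !Vw !mxE !eqxx (negbTE ij) /= mulr1 mulr0 => wj0.
case/negP: (w_neq0 j); apply/eqP/matrixP => x k; rewrite ord1 [RHS]mxE.
by rewrite cj [LHS]mxE wj0.
Qed.

(** Conjugation preserves the characteristic polynomial, so its roots are the entries of [d].
    Sorting them gives an admissible sequence, which rules out the default [[::]] of [xget]. *)
Let eigenvalues_perm : perm_eq (eigenvalues P) [seq d 0 i | i <- enum 'I_n] /\
  sorted (fun a b : R => b <= a) (eigenvalues P).
Proof.
have cP : char_poly P = \prod_(a <- [seq d 0 i | i <- enum 'I_n]) ('X - a%:P).
  have <- : char_poly (diag_mx d) = char_poly P.
    rewrite -[in RHS](fc_id Vunit VP) /fc map_mx_id// /char_poly.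
    have -> : char_poly_mx (invmx V *m diag_mx d *m V) =
      map_mx polyC (invmx V) *m char_poly_mx (diag_mx d) *m map_mx polyC V.
      rewrite /char_poly_mx mulmxBr mulmxBl -!map_mxM; congr (_ - _).
      by rewrite mul_mx_scalar -scalemxAl -map_mxM mulVmx// map_mx1 scalemx1.
    rewrite !det_mulmx mulrC mulrA -det_mulmx -map_mxM mulmxV// map_mx1 det1 mul1r//.
  rewrite char_poly_trig ?diag_mx_is_trig// big_map big_enum/=.
  by apply: eq_bigr => i _; rewrite mxE eqxx.
rewrite /eigenvalues; case: xgetP => [s ->|] /=.
  move=> [ss cs]; split=> //; apply: prod_XsubC_eq; by rewrite -cs -cP.
move=> /(_ (sort (fun a b : R => b <= a) [seq d 0 i | i <- enum 'I_n])) [].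
split; first by apply: sort_sorted => a b; exact: le_total.
rewrite cP; apply: perm_big; by rewrite perm_sym perm_sort.
Qed.

(** The eigenvalue 1 is the largest and occurs exactly once, so it is the head of the sorted
    sequence and the entry of index 1 is the largest of the others. *)
Lemma lambda2_spec : lambda2 P < 1 /\ (forall i, d 0 i != 1 -> d 0 i <= lambda2 P) /\
  exists i, d 0 i = lambda2 P.
Proof.
have [pe so] := eigenvalues_perm.
have sz := perm_size pe; rewrite size_map size_enum_ord in sz.
have cnt : count_mem 1 (eigenvalues P) = 1%N.
  have /permP -> := pe; rewrite count_map.
  have [i di] := ex_one.
  rewrite (eq_count (a2 := pred1 i)).
    by rewrite count_uniq_mem ?enum_uniq// mem_enum.
  move=> j /=; apply/eqP/eqP => [dj|->//]; exact: one_uniq.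
have memE := perm_mem pe.
rewrite /lambda2; case: (eigenvalues P) so sz cnt memE => [|a [|b s]] //=.
  by move=> _ E; exfalso; move: n_ge2; rewrite -E.
move=> so _ cnt memE.
have tr : transitive (fun a b : R => b <= a) by move=> y x z xy yz; exact: le_trans yz xy.
have /andP[ba] := so; rewrite path_sortedE// => /andP[/allP bs _].
have inle c : c \in a :: b :: s -> c <= 1.
  by rewrite memE => /mapP[i _ ->]; case/andP: (d_bound i).
have a1 : a = 1.
  apply/eqP; rewrite eq_le inle ?inE ?eqxx//=.
  have [i di] := ex_one.
  have : 1 \in a :: b :: s by rewrite memE -di map_f// mem_enum.
  rewrite !inE => /or3P[/eqP ->//|/eqP -> //|/bs h]; exact: le_trans ba.
have b1 : b != 1 by apply/eqP => b1; move: cnt; rewrite a1 b1 eqxx.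
split; first by rewrite lt_neqAle b1 inle// !inE eqxx orbT.
split=> [i di|].
  have : d 0 i \in a :: b :: s by rewrite memE map_f// mem_enum.
  by rewrite !inE a1 (negbTE di)/= => /orP[/eqP ->//|/bs].
have : b \in a :: b :: s by rewrite !inE eqxx orbT.
by rewrite memE => /mapP[i _ ->]; exists i.
Qed.

Lemma lambda2_lt1 : lambda2 P < 1. Proof. by case: lambda2_spec. Qed.

Lemma lambda2_eigen : exists f : 'cV[R]_n,
  [/\ f != 0, P *m f = lambda2 P *: f & mean pi f = 0].
Proof.
have [l1 [_ [i di]]] := lambda2_spec; exists (w i); split; rewrite -?di//.
have : mean pi (P *m w i) = mean pi (w i) by exact: mean_mul.
rewrite Pw -!ip_one ipZl di => /eqP; rewrite -subr_eq0 -{2}[ip _ _ _]mul1r -mulrBl.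
by rewrite mulf_eq0 subr_eq0 lt_eqF//= => /eqP.
Qed.

Lemma lambda2_ge0 : 0 <= lambda2 P.
Proof. by have [f [f0 Pf _]] := lambda2_eigen; case/andP: (eigen_bound Pf f0). Qed.

(* [B - phi] is nonnegative on the spectrum away from 1, hence there it is the
   square of a function of the self-adjoint operator P; the eigenspace of 1
   consists of constants and is orthogonal to f. *)
Lemma fc_gap phi B (f : 'cV[R]_n) : mean pi f = 0 ->
  (forall lam, 0 <= lam -> lam <= lambda2 P -> phi lam <= B) ->
  ip pi (fc V d phi *m f) f <= B * ip pi f f.
Proof.
move=> mf phiB; have [_ [dle _]] := lambda2_spec.
pose e (z : R) : R := (z == 1)%:R.
have Ef : fc V d e *m f = 0.
  pose h := fc V d e *m f.
  have Ph : P *m h = h.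
    rewrite /h mulmxA -{1}(fc_id Vunit VP) fc_mul//; congr (_ *m _); apply: fc_ext => i.
    by rewrite /e; case: eqP => [->|_]; rewrite ?mulr0 ?mulr1.
  have hc := harmonic_const sP iP Ph; apply/matrixP => x j; rewrite ord1 [RHS]mxE.
  have : mean pi h = 0.
    rewrite -ip_one /h reversible_ip; last exact: (fc_reversible Vunit VP).
    have -> : fc V d e *m (const_mx 1 : 'cV[R]_n) = e 1 *: const_mx 1.
      by apply: (fc_eigen Vunit VP); rewrite scale1r stochastic_one.
    by rewrite /e eqxx scale1r ip_one.
  rewrite /mean (eq_bigr (fun y => pi 0 y * h x 0)); last by move=> y _; congr (_ * _); exact: hc.
  by rewrite -mulr_suml pi1 mul1r.
(* Putting q(1) = 0 leaves a defect [B - phi 1] at the eigenvalue 1; it multiplies the spectral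
   projection [fc V d e], which kills [f]. *)
pose q (z : R) : R := if z == 1 then 0 else Num.sqrt (B - phi z).
have E : fc V d phi *m f = B *: f - fc V d q *m (fc V d q *m f).
  have -> : B *: f = B%:M *m f by rewrite mul_scalar_mx.
  have -> : fc V d q *m (fc V d q *m f) =
     fc V d q *m (fc V d q *m f) + (B - phi 1) *: (fc V d e *m f).
    by rewrite Ef scaler0 addr0.
  rewrite mulmxA fc_mul// scalemxAl -mulmxDl -mulmxBl; congr (_ *m _).
  apply/eqP; rewrite eq_sym subr_eq; apply/eqP.
  rewrite -(fc_cst d Vunit) -mul_scalar_mx -(fc_cst d Vunit) fc_mul// !fc_add.
  apply: fc_ext => i; rewrite /q /e; case: eqVneq => [->|di].
    by rewrite mulr1 mulr0; ring.
  rewrite mulr0 -expr2 sqr_sqrtr; first ring.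
  by rewrite subr_ge0 phiB ?dle//; case/andP: (d_bound i).
rewrite E ipBl ipZl gerBl reversible_ip; first exact: ip_ge0.
exact: (fc_reversible Vunit VP).
Qed.

End SecondEigenvalue.

(** * Stein's maximal inequality in L^2(pi) *)

Section MaximalInequality.
Context {R : realType} {n : nat}.
Implicit Types (f g h u : 'cV[R]_n).

(** Expand the nonnegative weighted sum of (d_i - r / W)^2, where r is the weighted sum of the
    d_i. *)
Lemma weighted_cauchy_schwarz (I : finType) (w d : I -> R) (W : R) :
  (forall i, 0 <= w i) -> 0 < W -> \sum_i w i <= W ->
  (\sum_i w i * d i) ^+ 2 <= W * \sum_i w i * d i ^+ 2.
Proof.
move=> w0 W0 wW; set r := \sum_i w i * d i; set G := \sum_i _.
have : 0 <= \sum_i w i * (d i - r / W) ^+ 2.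
  by apply: sumr_ge0 => i _; rewrite mulr_ge0 ?sqr_ge0.
have -> : \sum_i w i * (d i - r / W) ^+ 2 =
    G - 2 * (r / W) * r + (r / W) ^+ 2 * \sum_i w i.
  rewrite /r /G !mulr_sumr -/r -sumrB -big_split.
  by apply: eq_bigr => i _ /=; ring.
move=> H; have : (r / W) ^+ 2 * \sum_i w i <= (r / W) ^+ 2 * W.
  by rewrite ler_wpM2l ?sqr_ge0.
have -> : (r / W) ^+ 2 * W = r ^+ 2 / W by field; rewrite gt_eqF.
have E : 2 * (r / W) * r = 2 * (r ^+ 2 / W) by field; rewrite gt_eqF.
rewrite E in H => H2; have {}H : r ^+ 2 / W <= G by lra.
by rewrite mulrC -ler_pdivrMr.
Qed.

(* The hypotheses express complete monotonicity up to order 2; the sum is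
   dominated by the Abel sum of (j + 1) (a_j - 2 a_(j+1) + a_(j+2)). *)
Lemma abel_second_difference (a : nat -> R) N :
  (forall j, 0 <= a j) -> (forall j, 0 <= a j - a j.+1) ->
  (forall j, 0 <= a j - 2 * a j.+1 + a j.+2) ->
  \sum_(k < N) k.+1%:R * (a k.*2 - 2 * a k.*2.+1 + a k.*2.+2) <= a 0%N.
Proof.
move=> a0 b0 c0; pose c j := a j - 2 * a j.+1 + a j.+2.
(* The term of index k appears at index 2k with the coefficient 2k + 1 >= k + 1; the added odd terms
   are nonnegative. *)
have H1 : \sum_(k < N) k.+1%:R * c k.*2 <= \sum_(j < N.*2) j.+1%:R * c j.
  elim: N => [|N IH]; first by rewrite !big_ord0.
  rewrite doubleS !big_ord_recr/= -addrA; apply: lerD => //.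
  apply: ler_wpDr; first by rewrite mulr_ge0 ?c0.
  by rewrite ler_wpM2r ?c0// ler_nat ltnS -addnn leq_addr.
apply: le_trans H1 _.
have -> : \sum_(j < N.*2) j.+1%:R * c j =
   a 0%N - a N.*2 - (N.*2)%:R * (a N.*2 - a N.*2.+1).
  elim: (N.*2) => [|M IH]; first by rewrite big_ord0; ring.
  by rewrite big_ord_recr/= IH /c -natr1; ring.
have := a0 N.*2; have := mulr_ge0 (ler0n R N.*2) (b0 N.*2); lra.
Qed.

Variables (Q : 'M[R]_n) (pi : 'rV[R]_n).
Hypotheses (pi_gt0 : forall x, 0 < pi 0 x) (sQ : stochastic Q)
  (rQ : reversible Q pi) (psdQ : forall f, 0 <= ip pi (Q *m f) f).

Let pi_ge0 x : 0 <= pi 0 x. Proof. exact: ltW. Qed.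

Lemma ip_addX f g i j :
  ip pi (Q ^+ (i + j) *m f) g = ip pi (Q ^+ i *m f) (Q ^+ j *m g).
Proof.
rewrite addnC exprD -[Q ^+ j * _]/(_ *m _) -mulmxA.
by rewrite reversible_ip//; exact: reversibleX.
Qed.

Lemma mulXS k f : Q ^+ k.+1 *m f = Q *m (Q ^+ k *m f).
Proof. by rewrite exprS -[Q * _]/(_ *m _) mulmxA. Qed.

Lemma mulXSr k f : Q ^+ k.+1 *m f = Q ^+ k *m (Q *m f).
Proof. by rewrite exprSr -[_ * Q]/(_ *m _) mulmxA. Qed.

(** An even power gives the squared norm of a vector, an odd one leaves a single [Q] between two
    equal vectors. *)
Lemma psdX j f : 0 <= ip pi (Q ^+ j *m f) f.
Proof.
rewrite -[j]odd_double_half -addnn; case: odd => /=; last first.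
  by rewrite add0n ip_addX ip_ge0.
by rewrite addnA ip_addX add1n mulXS.
Qed.

(** With a_j = <Q^j f, f>, the k-th squared norm is the second difference a_(2k) - 2 a_(2k+1) +
    a_(2k+2). Second differences are nonnegative because they are <Q^j h, h> for h = f - Qf. *)
Lemma square_function_bound f N :
  \sum_(k < N) k.+1%:R * ip pi (Q ^+ k *m f - Q ^+ k.+1 *m f)
                              (Q ^+ k *m f - Q ^+ k.+1 *m f) <= ip pi f f.
Proof.
pose a j := ip pi (Q ^+ j *m f) f.
have c0 j : 0 <= a j - 2 * a j.+1 + a j.+2.
  have := psdX j (f - Q *m f); congr (0 <= _).
  rewrite mulmxBr -mulXSr !ipBl !ipBr -/(a j) -/(a j.+1).
  have E i : ip pi (Q ^+ i *m f) (Q *m f) = a i.+1.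
    by rewrite /a -[i.+1]addn1 ip_addX expr1.
  rewrite !E; ring.
have b0 j : 0 <= a j - a j.+1.
  have even i : 0 <= a i.*2 - a i.*2.+1.
    rewrite /a -[i.*2]addnn -[(i + i).+1]addSn !ip_addX mulXS subr_ge0.
    by case/andP: (ip_mul_bound (Q ^+ i *m f) pi_ge0 sQ rQ).
  rewrite -[j]odd_double_half; case: odd => /=; rewrite ?add0n ?add1n//.
  by have := c0 (j./2).*2.+1; have := even j./2.+1; rewrite doubleS; lra.
have -> : ip pi f f = a 0%N by rewrite /a expr0 mul1mx.
apply: le_trans (abel_second_difference N _ b0 c0); last by move=> j; exact: psdX.
apply: ler_sum => k _; rewrite ler_wpM2l//.
have E i j : ip pi (Q ^+ i *m f) (Q ^+ j *m f) = a (i + j)%N by rewrite /a ip_addX.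
by rewrite !ipBl !ipBr !E !addSn !addnS addnn; lra.
Qed.

(* Garsia's argument: on the exceptional set E the running maximum M of the
   sums of [Q^j (u - alpha)] satisfies [M <= u - alpha + Q M]. *)
Lemma maximal_ergodic u (alpha : R) N : (forall x, 0 <= u x 0) -> 0 < alpha ->
  alpha ^+ 2 * mass pi [set x | [exists k : 'I_N.+1,
     k%:R * alpha < (\sum_(j < k) Q ^+ j *m u) x 0]] <= ip pi u u.
Proof.
move=> u0 al0; set E := [set x | _]%SET.
pose A (k : nat) : 'cV[R]_n := \sum_(j < k) Q ^+ j *m u - const_mx (k%:R * alpha).
have A0 : A 0%N = 0 by rewrite /A big_ord0 mul0r sub0r; apply/matrixP=> i j; rewrite !mxE oppr0.
have cst c : const_mx c = c *: const_mx 1 :> 'cV[R]_n.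
  by apply/matrixP => i j; rewrite !mxE mulr1.
have AS k : A k.+1 = (u - const_mx alpha) + Q *m A k.
  rewrite /A big_ord_recl expr0 mul1mx mulmxBr mulmx_sumr.
  rewrite (eq_bigr (fun j : 'I_k => Q *m (Q ^+ j *m u))); last by move=> j _; exact: mulXS.
  rewrite (cst (k%:R * _)) -scalemxAr stochastic_one// -cst.
  rewrite -[in LHS]addrA -[RHS]addrA; congr (_ + _).
  rewrite [in RHS]addrCA; congr (_ + _).
  by apply/matrixP => i j; rewrite !mxE -natr1; ring.
pose M : 'cV[R]_n := \col_x \big[Num.max/0]_(k < N.+1) A k x 0.
have M0 x : 0 <= M x 0 by rewrite mxE; exact: bigmax_ge_id.
have AM (k : 'I_N.+1) x : A k x 0 <= M x 0.
  by rewrite [X in _ <= X]mxE; exact: (le_bigmax 0 (fun k : 'I_N.+1 => A k x 0) k).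
have AE k x : (0 < A k x 0) = (k%:R * alpha < (\sum_(j < k) Q ^+ j *m u) x 0).
  by rewrite /A mxE [X in _ + X]mxE [X in _ - X]mxE subr_gt0.
have MnE x : x \notin E -> M x 0 = 0.
  rewrite inE negb_exists => /forallP H; apply/eqP; rewrite eq_le M0 andbT mxE.
  by apply: bigmax_le => // k _; rewrite leNgt AE; exact: H.
have step (k : 'I_N.+1) x : (0 < k)%N -> A k x 0 <= u x 0 - alpha + (Q *m M) x 0.
  case: k => -[|k] Hk//= _; rewrite AS mxE [X in X + _]mxE [X in _ + X + _]mxE.
  rewrite [X in _ - X]mxE lerD2l; apply: stochastic_le => // y.
  exact: (AM (Ordinal (ltnW Hk))).
have ME x : x \in E -> M x 0 <= u x 0 - alpha + (Q *m M) x 0.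
  rewrite inE => /existsP[k0]; rewrite -AE => H.
  have pos : 0 < u x 0 - alpha + (Q *m M) x 0.
    have k0gt0 : (0 < k0)%N.
      by case: k0 H => -[]//= ?; rewrite A0 mxE ltxx.
    exact: lt_le_trans H (step _ _ k0gt0).
  rewrite [X in X <= _]mxE; apply: bigmax_le => [|k _]; first exact: ltW.
  have [k0'|] := posnP k; first by rewrite k0' A0 mxE ltW.
  exact: step.
(* Integrate the bound [ME] over E: [M] vanishes off E and [Q] preserves the mean, so the terms in
   [M] cancel. *)
have key : 0 <= \sum_(x in E) pi 0 x * (u x 0 - alpha).
  have : mean pi (Q *m M) = mean pi M by exact: mean_mul.
  have -> : mean pi M = \sum_(x in E) pi 0 x * M x 0.
    rewrite /mean (bigID (mem E))/= [X in _ + X]big1 ?addr0// => x xE.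
    by rewrite MnE// mulr0.
  have : \sum_(x in E) pi 0 x * (Q *m M) x 0 <= mean pi (Q *m M).
    rewrite /mean [X in _ <= X](bigID (mem E))/= lerDl; apply: sumr_ge0 => x _.
    rewrite mulr_ge0// mxE; apply: sumr_ge0 => y _.
    by rewrite mulr_ge0// stochastic_ge0.
  have : \sum_(x in E) pi 0 x * M x 0 <= \sum_(x in E) pi 0 x * (u x 0 - alpha) +
     \sum_(x in E) pi 0 x * (Q *m M) x 0.
    rewrite -big_split; apply: ler_sum => x xE /=.
    by rewrite -mulrDr ler_wpM2l// ME.
  lra.
have : \sum_(x in E) pi 0 x * (u x 0 * u x 0) <= ip pi u u.
  rewrite /ip [X in _ <= X](bigID (mem E))/= lerDl; apply: sumr_ge0 => x _.
  by rewrite mulr_ge0// -expr2 sqr_ge0.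
apply: le_trans.
(* On E, write u^2 - alpha^2 = (u - alpha)^2 + 2 alpha (u - alpha); both terms have nonnegative
   integral, the second by [key]. *)
have : 0 <= 2 * alpha * \sum_(x in E) pi 0 x * (u x 0 - alpha).
  by rewrite mulr_ge0// mulr_ge0// ltW.
have : 0 <= \sum_(x in E) pi 0 x * (u x 0 - alpha) ^+ 2.
  by apply: sumr_ge0 => x _; rewrite mulr_ge0 ?sqr_ge0.
rewrite /mass !mulr_sumr => H1 H2; rewrite -subr_ge0.
apply: le_trans (addr_ge0 H1 H2) _; rewrite -big_split -sumrB /=.
by apply: ler_sum => x _; rewrite le_eqVlt; apply/orP; left; apply/eqP; ring.
Qed.

(** Summation by parts: the sum exceeds k + 1 copies of its last term by the increments, each
    counted as often as it occurs. *)
Lemma sum_minus_remainder f k :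
  k.+1%:R *: (Q ^+ k *m f) = \sum_(j < k.+1) Q ^+ j *m f -
    \sum_(j < k) j.+1%:R *: (Q ^+ j *m f - Q ^+ j.+1 *m f).
Proof.
elim: k => [|k IH]; first by rewrite big_ord1 big_ord0 subr0 scale1r.
rewrite big_ord_recr [in X in _ - X]big_ord_recr/= opprD.
rewrite addrACA -IH -[in LHS]natr1 scalerDl scale1r scalerBr.
by rewrite opprB [RHS]addrCA subrKC addrC.
Qed.

Lemma mass_setU_le (A B C : {set 'I_n}) : A \subset B :|: C ->
  mass pi A <= mass pi B + mass pi C.
Proof.
move=> /fintype.subsetP sub; rewrite /mass !(big_mkcond (fun x => x \in _)) -big_split/=.
apply: ler_sum => x _; have := sub x; rewrite inE.
case: (x \in A); last by move=> _; do 2!case: ifP => _; rewrite ?addr0 ?add0r ?addr_ge0.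
by move=> /(_ isT) /orP[] ->; case: ifP => _; rewrite ?addr0 ?add0r// lerDl.
Qed.

(* Stein's decomposition: [Q^k f] is an ergodic average of [f] plus a
   remainder controlled by the square function. *)
Lemma maximal_inequality f (m2 : R) N : 0 < m2 ->
  mass pi [set y | [exists k : 'I_N.+1,
     m2 * ip pi f f < ((Q ^+ k *m f) y 0) ^+ 2]] <= 6 / m2.
Proof.
move=> m20.
have [f0|fn0] := eqVneq f 0.
  rewrite /mass big_pred0 ?divr_ge0 ?ltW// => y; rewrite inE; apply/negbTE/negP.
  case/existsP => k; rewrite f0 mulmx0 !mxE /ip big1 ?mulr0 ?expr0n ?ltxx//.
  by move=> x _; rewrite !mxE mul0r mulr0.
set s2 := ip pi f f.
have s20 : 0 < s2.
  by rewrite lt_neqAle ip_ge0// andbT eq_sym; apply: contra fn0 => /eqP/ip_eq0->.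
(* Half of the threshold: the ergodic average and the remainder are each allowed [al]. *)
pose al : R := Num.sqrt (m2 * s2) / 2.
have al0 : 0 < al by rewrite divr_gt0// sqrtr_gt0 mulr_gt0.
have al2 : m2 * s2 = 4 * al ^+ 2.
  by rewrite /al exprMn sqr_sqrtr ?mulr_ge0 ?ltW// ; field.
pose u : 'cV[R]_n := map_mx Num.norm f.
have uu : ip pi u u = s2.
  by apply: eq_bigr => x _; rewrite !mxE -normrM ger0_norm// -expr2 sqr_ge0.
have u0 x : 0 <= u x 0 by rewrite mxE.
pose D j := Q ^+ j *m f - Q ^+ j.+1 *m f.
pose g2 y := \sum_(j < N) j.+1%:R * (D j y 0) ^+ 2.
(* The average attached to Q^k has k + 1 terms and k may equal N, hence [N.+2]. *)
set E := [set x | [exists k : 'I_N.+2,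
     k%:R * al < (\sum_(j < k) Q ^+ j *m u) x 0]]%SET.
(* The weights j + 1 for j < k add up to at most (k + 1)^2 / 2, so by Cauchy-Schwarz g2 <= 2 al^2
   bounds the remainder by (k + 1) al. *)
pose F := [set y | 2 * al ^+ 2 < g2 y]%SET.
have mE : mass pi E <= 4 / m2.
  have := @maximal_ergodic u al N.+1 u0 al0; rewrite uu -/E => H.
  rewrite ler_pdivlMr// -(ler_pM2l s20).
  have -> : s2 * (mass pi E * m2) = m2 * s2 * mass pi E by ring.
  by rewrite al2; lra.
have mF : mass pi F <= 2 / m2.
  have : 2 * al ^+ 2 * mass pi F <= s2.
    apply: le_trans (square_function_bound f N).
    have -> : \sum_(k < N) k.+1%:R * ip pi (D k) (D k) = \sum_y pi 0 y * g2 y.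
      rewrite /ip /g2; under eq_bigr do rewrite mulr_sumr.
      rewrite exchange_big; apply: eq_bigr => y _ /=.
      by rewrite mulr_sumr; apply: eq_bigr => j _; rewrite expr2; ring.
    rewrite [X in _ <= X](bigID (mem F))/=; apply: ler_wpDr.
      apply: sumr_ge0 => y _; rewrite mulr_ge0//; apply: sumr_ge0 => j _.
      by rewrite mulr_ge0 ?sqr_ge0.
    rewrite /mass mulr_sumr; apply: ler_sum => y; rewrite inE => /ltW h.
    by rewrite mulrC ler_wpM2l.
  move=> H; rewrite ler_pdivlMr// -(ler_pM2l s20).
  have -> : s2 * (mass pi F * m2) = m2 * s2 * mass pi F by ring.
  by rewrite al2; lra.
apply: le_trans (_ : mass pi E + mass pi F <= _); last first.
  have -> : 6 / m2 = 4 / m2 + 2 / m2 by ring.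
  exact: lerD.
apply: mass_setU_le; apply/fintype.subsetP => y; apply: contraLR.
rewrite !inE negb_or !negb_exists -leNgt => /andP[/forallP HE HF].
apply/forallP => k; rewrite -leNgt al2.
have kN : (k.+1 < N.+2)%N by rewrite ltnS.
have := HE (Ordinal kN); rewrite -leNgt /= => Hs.
have k0 : 0 < k.+1%:R :> R by rewrite ltr0n.
pose q := (Q ^+ k *m f) y 0.
pose s := (\sum_(j < k.+1) Q ^+ j *m f) y 0.
pose r := (\sum_(j < k) j.+1%:R *: D j) y 0.
have eq_q : k.+1%:R * q = s - r.
  have /matrixP/(_ y 0) := sum_minus_remainder f k.
  by rewrite [LHS]mxE [RHS]mxE [X in _ = _ + X -> _]mxE.
rewrite -/q.
have s_le : `|s| <= k.+1%:R * al.
  apply: le_trans Hs; rewrite /s !summxE; apply: le_trans (ler_norm_sum _ _ _) _.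
  by apply: ler_sum => j _; apply: stochastic_norm; exact: stochasticX.
have r_le : `|r| <= k.+1%:R * al.
  have rE : r = \sum_(j < k) j.+1%:R * D j y 0.
    by rewrite /r summxE; apply: eq_bigr => j _; rewrite mxE.
  have : r ^+ 2 <= k.+1%:R ^+ 2 / 2 * \sum_(j < k) j.+1%:R * (D j y 0) ^+ 2.
    rewrite rE; apply: (weighted_cauchy_schwarz (w := fun j : 'I_k => j.+1%:R)).
    - by [].
    - by rewrite divr_gt0// exprn_gt0.
    rewrite ler_pdivlMr//; elim: (nat_of_ord k) => [|j IH].
      by rewrite big_ord0 mul0r sqr_ge0.
    rewrite big_ord_recr/= mulrDl; apply: le_trans (lerD IH (lexx _)) _.
    by rewrite -[j.+2%:R]natr1 -subr_ge0; set z : R := j.+1%:R;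
       rewrite (_ : _ - _ = 1)//; ring.
  have : \sum_(j < k) j.+1%:R * (D j y 0) ^+ 2 <= g2 y.
    have kN' : (k <= N)%N by rewrite -ltnS.
    rewrite /g2 (big_ord_widen N (fun j => j.+1%:R * (D j y 0) ^+ 2) kN').
    rewrite big_mkcond; apply: ler_sum => j _; case: ifP => // _.
    by rewrite mulr_ge0 ?sqr_ge0.
  move=> H1 H2; rewrite -ler_sqr ?nnegrE ?mulr_ge0// ?(ltW al0)//.
  rewrite real_normK ?num_real//; apply: le_trans H2 _.
  rewrite exprMn -mulrA ler_wpM2l ?sqr_ge0//.
  by have := le_trans H1 HF; lra.
have q_le : `|q| <= 2 * al.
  rewrite -(ler_pM2l k0) -{1}(ger0_norm (ltW k0)) -normrM eq_q.
  by apply: le_trans (ler_normB _ _) _; lra.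
rewrite -(real_normK (num_real q)).
have -> : 4 * al ^+ 2 = (2 * al) ^+ 2 by ring.
by rewrite ler_sqr ?nnegrE ?mulr_ge0// ltW.
Qed.

End MaximalInequality.

(** * Total variation distance and test functions *)

Section TotalVariation.
Context {R : realType} {n : nat}.
Implicit Types (mu nu pi : 'rV[R]_n) (f g h : 'cV[R]_n) (A : {set 'I_n}).

(** The extremal set is where mu < nu. Equal total masses make one-sided deviations sufficient,
    which is why only upper bounds on pi(A) - P^t(x, A) are needed later. *)
Lemma tv_dist_le mu nu (r : R) : distribution_vec mu -> distribution_vec nu ->
  (forall A, mass nu A - mass mu A <= r) -> tv_dist mu nu <= r.
Proof.
move=> [_ mu1] [_ nu1] H; pose A := [set x | mu 0 x < nu 0 x]%SET.
have E : \sum_x `|mu 0 x - nu 0 x| =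
    2 * (mass nu A - mass mu A) + \sum_x (mu 0 x - nu 0 x).
  rewrite /mass !(big_mkcond (fun x => x \in A)) -sumrB mulr_sumr -!big_split/=.
  apply: eq_bigr => x _; rewrite inE; case: ltP => h; last first.
    by rewrite ger0_norm ?subr_ge0//; ring.
  by rewrite ler0_norm ?subr_le0 1?ltW//; ring.
have S0 : \sum_x (mu 0 x - nu 0 x) = 0 by rewrite sumrB mu1 nu1 subrr.
rewrite /tv_dist E S0.
have := H A; lra.
Qed.

(** Since mu - nu has total mass 0, f may be replaced by f - 1/2, whose absolute value is at most
    1/2. *)
Lemma tv_dist_test mu nu f : distribution_vec mu -> distribution_vec nu ->
  (forall x, 0 <= f x 0 <= 1) -> mean mu f <= mean nu f + tv_dist mu nu.
Proof.
move=> [_ mu1] [_ nu1] f01; rewrite -subr_ge0 /mean /tv_dist.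
have S0 : \sum_x (mu 0 x - nu 0 x) = 0 by rewrite sumrB mu1 nu1 subrr.
have -> : \sum_x nu 0 x * f x 0 + 2^-1 * (\sum_x `|mu 0 x - nu 0 x|) -
    \sum_x mu 0 x * f x 0 = \sum_x (2^-1 * `|mu 0 x - nu 0 x| -
      (mu 0 x - nu 0 x) * (f x 0 - 2^-1)) - 2^-1 * \sum_x (mu 0 x - nu 0 x).
  rewrite !mulr_sumr -big_split -!sumrB; apply: eq_bigr => x _ /=; lra.
rewrite S0 mulr0 subr0; apply: sumr_ge0 => x _; have /andP[f0 f1] := f01 x.
rewrite subr_ge0 (le_trans (ler_norm _))// normrM mulrC ler_wpM2r//.
by rewrite ler_norml; apply/andP; split; lra.
Qed.

(** For functions of both signs no centering is available; the resulting factor 2 is the one in |log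
    2 eps|. *)
Lemma tv_dist_mean mu nu f (r : R) : (forall x, `|f x 0| <= r) ->
  `|mean mu f - mean nu f| <= 2 * r * tv_dist mu nu.
Proof.
move=> fr; rewrite /mean -sumrB; apply: le_trans (ler_norm_sum _ _ _) _.
rewrite /tv_dist mulrA mulr_sumr; apply: ler_sum => x _.
rewrite -mulrBl normrM mulrC ler_wpM2r//.
have := fr x; lra.
Qed.

End TotalVariation.

(** * Avoidance probabilities: decay from stationarity and use for mixing *)

Section Avoidance.
Context {R : realType} {n : nat}.
Implicit Types (Q : 'M[R]_n) (pi : 'rV[R]_n) (f g h : 'cV[R]_n) (A G : {set 'I_n}).

Definition indic A : 'cV[R]_n := \col_x (x \in A)%:R.

(* [avoid Q A k x] is the probability that the chain with transition matrix Q
   started at x does not visit A at the times 0, ..., k. *)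
Fixpoint avoid Q A (k : nat) : 'cV[R]_n :=
  if k is k'.+1 then \col_x ((x \notin A)%:R * (Q *m avoid Q A k') x 0)
  else indic (~: A).

Lemma avoid_in Q A k x : x \in A -> avoid Q A k x 0 = 0.
Proof. by move=> xA; case: k => [|k]; rewrite mxE ?inE xA ?mul0r. Qed.

Lemma avoidS Q A k x : x \notin A -> avoid Q A k.+1 x 0 = (Q *m avoid Q A k) x 0.
Proof. by move=> xA /=; rewrite [LHS]mxE xA mul1r. Qed.

Lemma avoid_bound Q A k x : stochastic Q -> 0 <= avoid Q A k x 0 <= 1.
Proof.
move=> sQ; elim: k x => [|k IH] x.
  by rewrite mxE inE; case: (x \in A) => /=; rewrite ?lexx ler01.
have [xA|xA] := boolP (x \in A); first by rewrite avoid_in// lexx ler01.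
rewrite avoidS// mxE; apply/andP; split.
  by apply: sumr_ge0 => y _; rewrite mulr_ge0 ?stochastic_ge0//; case/andP: (IH y).
rewrite -(stochastic_sum x sQ); apply: ler_sum => y _.
by rewrite ler_piMr ?stochastic_ge0//; case/andP: (IH y).
Qed.

(** Visits to A during the first k steps are simply ignored. *)
Lemma avoid_add_le Q A k s x : stochastic Q ->
  avoid Q A (k + s) x 0 <= (Q ^+ k *m avoid Q A s) x 0.
Proof.
move=> sQ; elim: k x => [|k IH] x; first by rewrite expr0 mul1mx.
have [xA|xA] := boolP (x \in A); last by rewrite addSn avoidS// mulXS stochastic_le.
rewrite avoid_in// mxE; apply: sumr_ge0 => y _.
rewrite mulr_ge0 ?stochastic_ge0//; last by case/andP: (avoid_bound A s y sQ).
exact: stochasticX.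
Qed.

(* Strong Markov property at the hitting time of G. *)
Lemma avoid_stopping Q G f (a M : R) N : stochastic Q ->
  (forall x, f x 0 <= a) ->
  (forall k y, (k <= N)%N -> y \in G -> (Q ^+ k *m f) y 0 <= M) ->
  forall k x, (k <= N)%N ->
    (Q ^+ k *m f) x 0 <= avoid Q G k x 0 * a + (1 - avoid Q G k x 0) * M.
Proof.
move=> sQ fa fM; elim=> [|k IH] x kN.
  have [xG|xG] := boolP (x \in G).
    by rewrite avoid_in// mul0r add0r subr0 mul1r fM.
  by rewrite expr0 mul1mx mxE inE xG /= mul1r subrr mul0r addr0.
have [xG|xG] := boolP (x \in G).
  by rewrite avoid_in// mul0r add0r subr0 mul1r fM.
rewrite avoidS// mulXS.
pose g : 'cV[R]_n := \col_y (avoid Q G k y 0 * a + (1 - avoid Q G k y 0) * M).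
apply: le_trans (stochastic_le (g := g) x sQ _) _ => [y|].
  by rewrite [X in _ <= X]mxE; apply: IH; exact: ltnW.
rewrite le_eqVlt; apply/orP; left; apply/eqP.
have -> : g = (a - M) *: avoid Q G k + M *: const_mx 1.
  apply/matrixP => y j; rewrite ord1 [LHS]mxE [RHS]mxE [X in _ = X + _]mxE.
  by rewrite [X in _ = _ + X]mxE [X in M * X]mxE; ring.
rewrite mulmxDr -!scalemxAr stochastic_one// [LHS]mxE [X in X + _]mxE.
by rewrite [X in _ + X]mxE [X in M * X]mxE; ring.
Qed.

Lemma mean_indic pi A : mean pi (indic A) = mass pi A.
Proof.
rewrite /mean /mass [RHS]big_mkcond; apply: eq_bigr => x _; rewrite mxE.
by case: ifP; rewrite ?mulr1 ?mulr0.
Qed.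

Lemma mass_setC pi A : distribution_vec pi -> mass pi (~: A) = 1 - mass pi A.
Proof.
move=> [_ pi1]; rewrite -pi1 [X in _ = X - _](bigID (mem A))/= -/(mass pi A) addrAC subrr add0r.
by apply: eq_bigl => x; rewrite inE.
Qed.

Lemma mass_ge0 pi A : distribution_vec pi -> 0 <= mass pi A.
Proof. by case=> pi0 _; apply: sumr_ge0. Qed.

Lemma mass_le1 pi A : distribution_vec pi -> mass pi A <= 1.
Proof. by move=> dpi; have := mass_ge0 (~: A) dpi; rewrite mass_setC// subr_ge0. Qed.

Lemma mass_row Q x A : mass (row x Q) A = (Q *m indic A) x 0.
Proof.
rewrite -mean_indic /mean mxE; apply: eq_bigr => y _; by rewrite mxE.
Qed.

Lemma mean_row Q x f : mean (row x Q) f = (Q *m f) x 0.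
Proof. by rewrite /mean mxE; apply: eq_bigr => y _; rewrite mxE. Qed.

Variables (Q : 'M[R]_n) (pi : 'rV[R]_n).
Hypotheses (pi_gt0 : forall x, 0 < pi 0 x) (dpi : distribution_vec pi)
  (sQ : stochastic Q)
  (rQ : reversible Q pi) (psdQ : forall f, 0 <= ip pi (Q *m f) f).

Let pi_ge0 x : 0 <= pi 0 x. Proof. exact: ltW. Qed.

Lemma mean_cst (c : R) : mean pi (const_mx c) = c.
Proof.
rewrite /mean (eq_bigr (fun x => pi 0 x * c)); last by move=> x _; rewrite mxE.
by rewrite -mulr_suml; case: dpi => _ ->; rewrite mul1r.
Qed.

Lemma const_mxZ (c : R) : const_mx c = c *: const_mx 1 :> 'cV[R]_n.
Proof. by apply/matrixP => i j; rewrite !mxE mulr1. Qed.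

(* The operator killed on A has norm at most gamma on functions supported off
   A, and [avoid Q A k] is its k-th power applied to the indicator of the
   complement. *)
Lemma mean_avoid_le A (lam beta gam : R) k :
  (forall f, mean pi f = 0 -> ip pi (Q *m f) f <= lam * ip pi f f) ->
  lam <= 1 -> 0 < beta -> 1 - beta <= mass pi A ->
  0 < gam -> lam + (1 - lam) * beta <= gam ->
  mean pi (avoid Q A k) <= gam ^+ k * beta.
Proof.
move=> gap lam1 beta0 massA gam0 Hgam.
have supp i x : x \in A -> avoid Q A i x 0 = 0 by exact: avoid_in.
(* Split f into its mean and a centered part, to which the gap applies. As f lives off A, of
   complement mass at most beta, Cauchy-Schwarz bounds the squared mean by beta <f, f>. *)
have rayleigh f : (forall x, x \in A -> f x 0 = 0) ->
    ip pi (Q *m f) f <= gam * ip pi f f.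
  move=> f0; pose m := mean pi f; pose g := f - m *: const_mx 1.
  have g0 : mean pi g = 0.
    rewrite -ip_one ipBl ipZl !ip_one -/m const_mxZ scale1r.
    by have := mean_cst 1; rewrite /m => ->; rewrite mulr1 subrr.
  have one1 : ip pi (const_mx 1) (const_mx 1) = 1 by rewrite ip_one mean_cst.
  have := gap g g0.
  rewrite /g mulmxBr -scalemxAr stochastic_one// !ipBl !ipZl !ipBr !ipZr one1.
  rewrite (ipC pi (const_mx 1) f) !ip_one mean_mul// -/m => H.
  have m2 : m ^+ 2 <= beta * ip pi f f.
    have -> : m = \sum_x (if x \in A then 0 else pi 0 x) * f x 0.
      by apply: eq_bigr => x _; case: ifP => // /f0 ->; rewrite !mulr0.
    apply: le_trans (weighted_cauchy_schwarz (W := beta) _ _ _ _) _ => //.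
    - by move=> x; case: ifP.
    - have := mass_setC A dpi; rewrite /mass => E.
      rewrite (eq_bigr (fun x => if x \in ~: A then pi 0 x else 0)).
        by rewrite -big_mkcond/= E -/(mass pi A); lra.
      by move=> x _; rewrite inE; case: (x \in A).
    rewrite ler_pM2l//; apply: ler_sum => x _; rewrite expr2.
    by case: ifP => // _; rewrite mul0r mulr_ge0// -expr2 sqr_ge0.
  have ff0 := ip_ge0 f pi_ge0.
  have h1 : (1 - lam) * m ^+ 2 <= (1 - lam) * (beta * ip pi f f).
    by rewrite ler_wpM2l// subr_ge0.
  have h2 : (lam + (1 - lam) * beta) * ip pi f f <= gam * ip pi f f.
    by rewrite ler_wpM2r.
  by move: H h1 h2; lra.
pose g i := avoid Q A i; pose a i := mean pi (g i).
have shift i j : ip pi (g i.+1) (g j) = ip pi (Q *m g i) (g j).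
  apply: eq_bigr => x _; have [xA|xA] := boolP (x \in A).
    by rewrite /g (supp j)// !mulr0.
  by rewrite /g avoidS.
have ipg i j : ip pi (g i) (g j) = a (i + j)%N.
  elim: j i => [|j IH] i.
    rewrite addn0 /a /mean /ip; apply: eq_bigr => x _; rewrite [g 0%N x 0]mxE inE.
    by case: (boolP (x \in A)) => xA; rewrite ?mulr1// /g supp// mul0r.
  by rewrite addnS -addSn -IH [LHS]ipC shift reversible_ip// [LHS]ipC shift.
have a0 i : 0 <= a i.
  apply: sumr_ge0 => x _; rewrite mulr_ge0//; by case/andP: (avoid_bound A i x sQ).
have odd_step i : a i.*2.+1 <= gam * a i.*2.
  rewrite -addnn -addSn -!ipg shift; apply: rayleigh => x; exact: supp.
(* Semidefiniteness gives 2 a_(2i+2) / gam <= a_(2i+1) + a_(2i+3) / gam^2, and the last term is at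
   most a_(2i+2) / gam by [odd_step]. *)
have even_step i : a i.*2.+2 <= gam * a i.*2.+1.
  have := psdQ (g i - gam^-1 *: g i.+1).
  rewrite mulmxBr -scalemxAr !ipBl !ipBr !ipZl !ipZr -!shift !ipg.
  rewrite !addSn !addnS addnn.
  have := odd_step i.+1; rewrite doubleS => h h'.
  rewrite -(ler_pM2l (_ : 0 < gam^-1)) ?invr_gt0// mulKf ?gt_eqF//.
  have h2 : gam^-1 * (gam^-1 * a i.*2.+3) <= gam^-1 * a i.*2.+2.
    by rewrite ler_pM2l ?invr_gt0// -(ler_pM2l gam0) mulVKf ?gt_eqF.
  lra.
have step i : a i.+1 <= gam * a i.
  rewrite -[i]odd_double_half; case: odd; rewrite ?add0n ?add1n; first exact: even_step.
  exact: odd_step.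
rewrite -/(g k) -/(a k); elim: k => [|k IH].
  rewrite expr0 mul1r /a /g /= mean_indic mass_setC//; lra.
by rewrite exprS -mulrA (le_trans (step k))// ler_pM2l.
Qed.

Lemma ip_centered_indic A (e := indic A - const_mx (mass pi A)) :
  mean pi e = 0 /\ ip pi e e = mass pi A * (1 - mass pi A).
Proof.
have ce : const_mx (mass pi A) = mass pi A *: const_mx 1 :> 'cV[R]_n by exact: const_mxZ.
have ii : ip pi (indic A) (indic A) = mass pi A.
  rewrite -mean_indic; apply: eq_bigr => x _; rewrite mxE.
  by case: (x \in A); rewrite ?mulr1 ?mulr0.
have one1 : ip pi (const_mx 1) (const_mx 1) = 1 by rewrite ip_one mean_cst.
split; first by rewrite -ip_one /e ce ipBl ipZl one1 ip_one mean_indic mulr1 subrr.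
rewrite /e ce !ipBl !ipZl !ipBr !ipZr one1 ii (ipC _ (const_mx 1)) ip_one mean_indic.
ring.
Qed.

(** [K] is the evolution during the waiting time and f = - K e the deviation of the test set A.
    Everywhere f <= a, and on the good set the iterates of f are at most M, so stopping at its
    hitting time gives v a + (1 - v) M. The last hypothesis isolates the remaining numerical
    inequality, named [mixture_le] below. *)
Lemma tv_le_of_avoid (K : 'M[R]_n) N (alpha m2 rho2 p r : R) : stochastic K ->
  0 < m2 -> 6 / m2 <= 1 - alpha ->
  (forall e, mean pi e = 0 -> ip pi (K *m e) (K *m e) <= rho2 * ip pi e e) ->
  (forall x G, alpha <= mass pi G -> avoid Q G N x 0 <= p) ->
  (forall a M v, 0 <= a <= 1 -> 0 <= M -> M ^+ 2 <= m2 * rho2 * (a * (1 - a)) ->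
     0 <= v <= p -> v * a + (1 - v) * M <= r) ->
  forall x, tv_dist (row x (Q ^+ N *m K)) pi <= r.
Proof.
move=> sK m20 Hm2 contr Hav Hnum x.
apply: tv_dist_le => //.
  by apply: stochastic_mul => //; exact: stochasticX.
move=> A; set a := mass pi A.
have a01 : 0 <= a <= 1 by rewrite mass_ge0// mass_le1.
have [e0 ee] := ip_centered_indic A; set e := indic A - _ in e0 ee.
pose f := - (K *m e).
have fE : f = const_mx a - K *m indic A.
  rewrite /f /e mulmxBr const_mxZ -scalemxAr stochastic_one// -const_mxZ opprB//.
have fa y : f y 0 <= a.
  rewrite fE mxE [X in X + _]mxE gerDl mxE oppr_le0 mxE; apply: sumr_ge0 => z _.
  by rewrite mulr_ge0 ?stochastic_ge0// mxE.
have ff : ip pi f f <= rho2 * (a * (1 - a)).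
  rewrite -ee /f -scaleN1r ipZl ipZr mulrA mulrNN !mul1r; exact: contr.
have ff0 := ip_ge0 f pi_ge0.
pose M := Num.sqrt (m2 * ip pi f f).
have M2 : M ^+ 2 = m2 * ip pi f f by rewrite sqr_sqrtr// mulr_ge0// ltW.
pose B := [set y | [exists k : 'I_N.+1,
     m2 * ip pi f f < ((Q ^+ k *m f) y 0) ^+ 2]]%SET.
have massG : alpha <= mass pi (~: B).
  rewrite mass_setC//.
  by have := maximal_inequality pi_gt0 sQ rQ psdQ f N m20; rewrite -/B; lra.
have QfE : (Q ^+ N *m f) x 0 = a - mass (row x (Q ^+ N *m K)) A.
  rewrite mass_row fE mulmxBr mulmxA const_mxZ -scalemxAr.
  by rewrite stochastic_one ?mxE ?mxE ?mulr1//; exact: stochasticX.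
rewrite -QfE.
apply: le_trans (avoid_stopping (G := ~: B) (a := a) (M := M) (N := N) sQ fa _ _ _) _ => //.
  move=> k y kN; rewrite !inE negb_exists => /forallP/(_ (Ordinal (kN : (k < N.+1)%N))).
  rewrite -leNgt /= -M2 => h.
  apply: le_trans (ler_norm _) _.
  by rewrite -ler_sqr ?nnegrE ?sqrtr_ge0// real_normK ?num_real.
apply: Hnum => //.
- exact: sqrtr_ge0.
- by rewrite M2 -mulrA ler_pM2l.
- apply/andP; split; last exact: Hav.
  by case/andP: (avoid_bound (~: B) N x sQ).
Qed.

End Avoidance.

(** * From laws of cylinders to avoidance probabilities *)

Section MarkovLaw.
Context {R : realType} {n : nat} {d : measure_display} {T : measurableType d}.
Implicit Types (A : {set 'I_n}).

Lemma measurable_preim_pred (Z : T -> 'I_n) (p : pred 'I_n) :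
  (forall z, measurable (Z @^-1` [set z])) -> measurable [set w | p (Z w)].
Proof.
move=> mZ.
have -> : [set w | p (Z w)] = \bigcup_(z in [set z | p z]) Z @^-1` [set z].
  by apply/seteqP; split => [w pw|w [z pz /= ZE]]; [exists (Z w) | rewrite /= ZE].
by apply: fin_bigcup_measurable => //; exact: finite_finset.
Qed.

Lemma measurable_forall_le (m : nat) (F : nat -> set T) :
  (forall i, measurable (F i)) ->
  measurable [set w | forall i, (i <= m)%N -> F i w].
Proof.
move=> mF.
have -> : [set w | forall i, (i <= m)%N -> F i w] =
    \bigcap_i (if (i <= m)%N then F i else setT).
  apply/seteqP; split => [w Fw i _|w Fw i im]; first by case: ifP => // /Fw.
  by have := Fw i I; rewrite im.
by apply: bigcapT_measurable => i; case: ifP.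
Qed.

Lemma measure_partition (mu : {measure set T -> \bar R}) (E : set T) (Z : T -> 'I_n) :
  measurable E -> (forall z, measurable (Z @^-1` [set z])) ->
  mu E = (\sum_z mu (E `&` Z @^-1` [set z]))%E.
Proof.
move=> mE mZ; rewrite -(@measure_bigsetU_ord _ _ _ mu n predT
  (fun z => E `&` Z @^-1` [set z])).
- congr (mu _); rewrite -bigcup_seq.
  apply/seteqP; split => [w Ew|w [z _ []//]]; exists (Z w) => //=.
  exact: mem_index_enum.
- by move=> z; exact: measurableI.
- by move=> z z' _ _ [w [[_ <-] [_ <-]]].
Qed.

Variables (Pr : probability T R) (Y : nat -> T -> 'I_n) (mu : 'I_n -> R)
  (Q : 'M[R]_n).
Hypotheses (mY : forall t z, measurable (Y t @^-1` [set z]))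
  (law : forall (m : nat) (y : nat -> 'I_n),
    Pr [set w | forall i, (i <= m)%N -> Y i w = y i] =
    (mu (y 0%N) * \prod_(i < m) Q (y i) (y i.+1))%:E).

(** The law is given on cylinders only, so the Markov property is expressed by prescribing a path up
    to time j; the induction on k lengthens the path by the state at time j + 1. The initial weights
    [mu] are general because a grid may start at a positive time. *)
Lemma avoid_after_path A k j (y : nat -> 'I_n) :
  Pr [set w | (forall i, (i <= j)%N -> Y i w = y i) /\
              (forall i, (i <= k)%N -> Y (j + i)%N w \notin A)] =
  (mu (y 0%N) * \prod_(i < j) Q (y i) (y i.+1) * avoid Q A k (y j) 0)%:E.
Proof.
have empty k' j' y' : y' j' \in A ->
    Pr [set w | (forall i, (i <= j')%N -> Y i w = y' i) /\
              (forall i, (i <= k')%N -> Y (j' + i)%N w \notin A)] =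
  (mu (y' 0%N) * \prod_(i < j') Q (y' i) (y' i.+1) * avoid Q A k' (y' j') 0)%:E.
  move=> yA; rewrite avoid_in// mulr0 -[RHS](measure0 Pr); congr (Pr _).
  apply/seteqP; split => // w [/(_ _ (leqnn _)) h1 /(_ _ (leq0n _))].
  by rewrite addn0 h1 yA.
elim: k j y => [|k IH] j y; have [yA|yA] := boolP (y j \in A); try exact: empty.
  rewrite mxE inE yA mulr1 -law; congr (Pr _).
  apply/seteqP; split => [w []//|w h]; split => // i.
  by rewrite leqn0 => /eqP ->; rewrite addn0 h.
rewrite (measure_partition _ (Z := Y j.+1)) => [||z]; last exact: mY; last first.
  apply: measurableI; apply: measurable_forall_le => i.
    exact: mY.
  exact: (measurable_preim_pred (fun z => z \notin A)).
pose y' z i : 'I_n := if i == j.+1 then z else y i.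
rewrite avoidS// mxE mulr_sumr -sumEFin; apply: eq_bigr => z _.
have y'j i z' : (i <= j)%N -> y' z' i = y i.
  by rewrite /y'; case: eqP => // ->; rewrite ltnn.
have y'S : y' z j.+1 = z by rewrite /y' eqxx.
transitivity (Pr [set w | (forall i, (i <= j.+1)%N -> Y i w = y' z i) /\
              (forall i, (i <= k)%N -> Y (j.+1 + i)%N w \notin A)]).
  congr (Pr _); apply/seteqP; split => w /=.
    move=> [[h1 h2] h3]; split => i; last first.
      by move=> ik; rewrite addSnnS; apply: h2.
    rewrite leq_eqVlt => /orP[/eqP ->|]; first by rewrite h3 y'S.
    by rewrite ltnS => ij; rewrite h1// y'j.
  move=> [h1 h2]; split; last by rewrite /= h1// y'S.
  split=> [i ij|[_|i ik]]; first by rewrite h1 ?y'j// ltnW.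
    by rewrite addn0 h1 ?y'j.
  by rewrite -addSnnS; apply: h2.
rewrite IH big_ord_recr/= y'S !y'j//; congr (_%:E).
rewrite -!mulrA; congr (_ * (_ * _)); apply: eq_bigr => i _.
by rewrite !y'j// ltnW.
Qed.

Lemma avoid_law A m :
  Pr [set w | forall i, (i <= m)%N -> Y i w \notin A] =
  (\sum_z mu z * avoid Q A m z 0)%:E.
Proof.
rewrite (measure_partition _ (Z := Y 0%N)) => [||z]; last exact: mY; last first.
  apply: measurable_forall_le => i.
  exact: (measurable_preim_pred (fun z => z \notin A)).
rewrite -sumEFin; apply: eq_bigr => z _.
have := avoid_after_path A m 0 (fun=> z); rewrite big_ord0 mulr1 => <-.
congr (Pr _); apply/seteqP; split => w /=.
  by move=> [h1 h2]; split => // i; rewrite leqn0 => /eqP ->.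
by move=> [h1 h2]; split => //=; exact: h1.
Qed.

End MarkovLaw.

(** * Discrete hitting times *)

Section HittingTimes.
Context {R : realType} {n : nat} {d : measure_display} {T : measurableType d}.
Implicit Types (A : {set 'I_n}).

Lemma hitting_time_gt (X : nat -> T -> 'I_n) A (t : nat) :
  [set w | ((t%:R)%:E < hitting_time (R := R) X A w)%E] =
  [set w | forall i, (i <= t)%N -> X i w \notin A].
Proof.
apply/seteqP; split => w /=.
  move=> h i it; apply/negP => XA; move: h; apply/negP; rewrite -leNgt.
  apply: (@le_trans _ _ ((i%:R : R)%:E)); last by rewrite lee_fin ler_nat.
  by apply: ereal_inf_lbound; exists i.
move=> h; apply: (@lt_le_trans _ _ ((t.+1%:R : R)%:E)).
  by rewrite lte_fin ltr_nat.
apply: le_ereal_inf_tmp => _ [i /= Xi <-]; rewrite lee_fin ler_nat ltnNge.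
by apply/negP => /h; rewrite Xi.
Qed.

Variables (P : 'M[R]_n) (pi : 'rV[R]_n) (Pr : 'I_n -> probability T R).

Lemma p_hit_leP (X : nat -> T -> 'I_n) (alpha eps : R) t : markov_chain P Pr X ->
  0 <= eps ->
  p_hit pi Pr X alpha t <= eps <->
  forall x A, alpha <= mass pi A -> avoid P A t x 0 <= eps.
Proof.
move=> [mX law] eps0.
have E x A : fine (Pr x [set w | ((t%:R)%:E < hitting_time (R := R) X A w)%E]) = avoid P A t x 0.
  rewrite hitting_time_gt (avoid_law mX (mu := fun y => (y == x)%:R) (law x))/=.
  rewrite (bigD1 x)//= eqxx mul1r big1 ?addr0// => y yx.
  by rewrite (negbTE yx) mul0r.
split=> [h x A HA|h].
  rewrite -E; apply: le_trans h; rewrite /p_hit.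
  apply: le_trans (le_bigmax _ _ x).
  exact: (le_bigmax_cond _ (P := fun A : {set 'I_n} => alpha <= mass pi A)
    (fun A => fine (Pr x [set w | ((t%:R)%:E < hitting_time X A w)%E])) HA).
apply: bigmax_le => // x _; apply: bigmax_le => // A HA.
by rewrite E h.
Qed.

End HittingTimes.

(** * Spectral estimates for powers and for the heat kernel *)

Section HeatKernel.
Context {R : realType} {n : nat}.
Variables (P : 'M[R]_n) (pi : 'rV[R]_n).
Hypotheses (n_ge2 : (2 <= n)%N) (sP : stochastic P) (statP : stationary P pi)
  (iP : irreducible P) (rP : reversible P pi) (lP : lazy P).

Let pi_gt0 x : 0 < pi 0 x. Proof. exact: irreducible_pi_gt0 sP statP iP. Qed.
Let pi_ge0 x : 0 <= pi 0 x. Proof. exact: ltW. Qed.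

Lemma trel_gt0 : 0 < trel P.
Proof.
have [V [d Vunit VP]] := reversible_diag pi_gt0 rP.
by rewrite invr_gt0 subr_gt0 (lambda2_lt1 n_ge2 sP statP iP rP lP Vunit VP).
Qed.

Lemma trel_lambda2 : (trel P)^-1 = 1 - lambda2 P.
Proof. by rewrite invrK. Qed.

Lemma power_gap f t : mean pi f = 0 ->
  ip pi (P ^+ t *m f) f <= lambda2 P ^+ t * ip pi f f.
Proof.
move=> f0; have [V [d Vunit VP]] := reversible_diag pi_gt0 rP.
rewrite -(fcX Vunit VP).
apply: (fc_gap n_ge2 sP statP iP rP lP Vunit VP) => // l l0 ll.
by apply: lerXn2r => //; rewrite nnegrE// (le_trans l0).
Qed.

(** Self-adjointness turns the norm into <P^(2t) f, f>, and lambda2 <= exp(lambda2 - 1). *)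
Lemma power_contraction f t : mean pi f = 0 ->
  ip pi (P ^+ t *m f) (P ^+ t *m f) <= expR (- (2 * t%:R / trel P)) * ip pi f f.
Proof.
move=> f0; have [V [d Vunit VP]] := reversible_diag pi_gt0 rP.
have l0 := lambda2_ge0 n_ge2 sP statP iP rP lP Vunit VP.
have rX := @ip_addX R n P pi rP.
rewrite -rX; apply: le_trans (power_gap _ f0) _.
rewrite ler_wpM2r ?ip_ge0// trel_lambda2.
have -> : - (2 * t%:R * (1 - lambda2 P)) = (t + t)%:R * (lambda2 P - 1).
  by rewrite natrD; ring.
rewrite expRM_natl; apply: lerXn2r; rewrite ?nnegrE ?expR_ge0//.
by have := expR_ge1Dx (lambda2 P - 1); lra.
Qed.

Section Diagonalized.
Variables (V : 'M[R]_n) (d : 'rV[R]_n).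
Hypotheses (Vunit : V \in unitmx) (VP : V *m P = diag_mx d *m V).

(** Each entry of P^k is a finite combination of k-th powers of the eigenvalues, so the series is a
    finite combination of scalar exponential series. *)
Lemma heat_series_cvg (t : R) x y :
  series (fun k => expR (- t) * t ^+ k / k`!%:R * (P ^+ k) x y) @ \oo -->
  fc V d (fun z => expR (- (t * (1 - z)))) x y.
Proof.
have fcE phi : fc V d phi x y = \sum_i invmx V x i * V i y * phi (d 0 i).
  rewrite /fc mxE; apply: eq_bigr => i _; rewrite mul_mx_diag mxE mxE; ring.
pose c i := invmx V x i * V i y * expR (- t).
have -> : series (fun k => expR (- t) * t ^+ k / k`!%:R * (P ^+ k) x y) =
    fun N => \sum_i c i * series (exp_coeff (t * d 0 i)) N.
  apply/funext => N; rewrite /series/=.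
  under [RHS]eq_bigr do rewrite mulr_sumr.
  rewrite exchange_big/=; apply: eq_bigr => k _.
  rewrite -(fcX Vunit VP) fcE mulr_sumr; apply: eq_bigr => i _.
  by rewrite /c /exp_coeff /= exprMn; ring.
have -> : fc V d (fun z => expR (- (t * (1 - z)))) x y =
    \sum_i c i * expR (t * d 0 i).
  rewrite fcE; apply: eq_bigr => i _; rewrite /c -[RHS]mulrA -expRD.
  by congr (_ * expR _); ring.
apply: cvg_big => [|i _]; first exact: add_continuous.
apply: cvgMr => //; exact: is_cvg_series_exp_coeff.
Qed.

Lemma heat_kernelE t :
  heat_kernel P t = fc V d (fun z => expR (- (t * (1 - z)))).
Proof.
by apply/matrixP => x y; rewrite mxE; apply/cvg_lim => //; exact: heat_series_cvg.
Qed.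

End Diagonalized.

(** Nonnegativity is read off the series, the row sums off the action of the functional calculus on
    the eigenvector 1. *)
Lemma heat_stochastic t : 0 <= t -> stochastic (heat_kernel P t).
Proof.
move=> t0; have [V [d Vunit VP]] := reversible_diag pi_gt0 rP.
have HE := heat_kernelE Vunit VP t.
apply: stochasticP => [x y|x].
  rewrite mxE; apply: limr_ge.
    by apply/cvg_ex; eexists; exact: (heat_series_cvg Vunit VP).
  apply: nearW => N; apply: sumr_ge0 => k _.
  rewrite mulr_ge0 ?(stochastic_ge0 _ _ (stochasticX k sP))//.
  by rewrite divr_ge0// mulr_ge0 ?expR_ge0// exprn_ge0.
have : heat_kernel P t *m (const_mx 1 : 'cV[R]_n) = const_mx 1.
  rewrite HE; have := @fc_eigen R n P V d Vunit VP (fun z => expR (- (t * (1 - z)))) 1 (const_mx 1).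
  by rewrite scale1r subrr mulr0 oppr0 expR0 scale1r => -> //; exact: stochastic_one.
move=> /matrixP/(_ x 0); rewrite mxE [RHS]mxE => E; rewrite -[RHS]E.
by apply: eq_bigr => y _; rewrite [const_mx _ _ _]mxE mulr1.
Qed.

Lemma heat_reversible t : reversible (heat_kernel P t) pi.
Proof.
have [V [d Vunit VP]] := reversible_diag pi_gt0 rP.
by rewrite (heat_kernelE Vunit VP); exact: (fc_reversible Vunit VP).
Qed.

Lemma heat_kernelD s t : heat_kernel P s *m heat_kernel P t = heat_kernel P (s + t).
Proof.
have [V [d Vunit VP]] := reversible_diag pi_gt0 rP.
rewrite !(heat_kernelE Vunit VP) fc_mul//; apply: fc_ext => i.
by rewrite -expRD; congr expR; ring.
Qed.

Lemma heat_kernel0 : heat_kernel P 0 = 1.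
Proof.
have [V [d Vunit VP]] := reversible_diag pi_gt0 rP.
rewrite (heat_kernelE Vunit VP) -[RHS]/(1%:M) -(fc_cst d Vunit); apply: fc_ext => i.
by rewrite mul0r oppr0 expR0.
Qed.

Lemma heat_kernelX t k : heat_kernel P t ^+ k = heat_kernel P (k%:R * t).
Proof.
elim: k => [|k IH]; first by rewrite mul0r heat_kernel0.
rewrite exprS IH -[_ * _]/(_ *m _) heat_kernelD; congr heat_kernel.
by rewrite -natr1; ring.
Qed.

Lemma heat_ip s t f g :
  ip pi (heat_kernel P (s + t) *m f) g = ip pi (heat_kernel P s *m f) (heat_kernel P t *m g).
Proof.
by rewrite addrC -heat_kernelD -mulmxA reversible_ip//; exact: heat_reversible.
Qed.

Lemma heat_psd t f : 0 <= ip pi (heat_kernel P t *m f) f.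
Proof.
have -> : t = t / 2 + t / 2 by field.
by rewrite heat_ip ip_ge0.
Qed.

Lemma heat_gap t f : 0 <= t -> mean pi f = 0 ->
  ip pi (heat_kernel P t *m f) f <= expR (- (t / trel P)) * ip pi f f.
Proof.
move=> t0 f0; have [V [d Vunit VP]] := reversible_diag pi_gt0 rP.
rewrite (heat_kernelE Vunit VP) trel_lambda2.
apply: (fc_gap n_ge2 sP statP iP rP lP Vunit VP) => // l l0 ll.
by rewrite ler_expR lerN2 ler_wpM2l// lerB.
Qed.

Lemma heat_contraction t f : 0 <= t -> mean pi f = 0 ->
  ip pi (heat_kernel P t *m f) (heat_kernel P t *m f) <=
  expR (- (2 * t / trel P)) * ip pi f f.
Proof.
move=> t0 f0; rewrite -heat_ip.
have -> : 2 * t = t + t by ring.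
by apply: heat_gap => //; rewrite addr_ge0.
Qed.

Lemma heat_lambda2_eigen : exists f : 'cV[R]_n,
  [/\ f != 0, P *m f = lambda2 P *: f, mean pi f = 0 &
      forall t, heat_kernel P t *m f = expR (- (t / trel P)) *: f].
Proof.
have [V [d Vunit VP]] := reversible_diag pi_gt0 rP.
have [f [f0 Pf mf]] := lambda2_eigen n_ge2 sP statP iP rP lP Vunit VP.
exists f; split => // t; rewrite (heat_kernelE Vunit VP) trel_lambda2.
by rewrite (fc_eigen Vunit VP (fun z => expR (- (t * (1 - z)))) Pf).
Qed.

End HeatKernel.

(** * Numerical inequalities behind the constants *)

Section Numerics.
Context {R : realType}.
Implicit Types (a M v p r kap eps : R).

(* [v] is the probability of missing the good set, [a] the mass of the test
   set and [M] the deviation on the good set. *)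
Definition mixture_le kap p r := forall a M v, 0 <= a <= 1 -> 0 <= M ->
  M ^+ 2 <= kap * (a * (1 - a)) -> 0 <= v <= p -> v * a + (1 - v) * M <= r.

(** Grid probabilities exceed the true hitting probability by a small e; as a - M <= 1, the final
    bound loses at most e too. *)
Lemma mixture_leS kap p r e : 0 <= p -> 0 <= e ->
  mixture_le kap p r -> mixture_le kap (p + e) (r + e).
Proof.
move=> p0 e0 H a M v a01 M0 HM /andP[v0 vp].
have [vp'|pv] := leP v p; first by have := H a M v a01 M0 HM; rewrite v0 vp'; lra.
have := H a M p a01 M0 HM; rewrite p0 lexx => /(_ isT) h.
case/andP: a01 => a0 a1.
have h1 : (v - p) * (a - M) <= v - p.
  rewrite -[X in _ <= X]mulr1 ler_wpM2l//; lra.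
lra.
Qed.

(** AM-GM in the form (th a + be (1 - a))^2 >= 4 th be a (1 - a). It replaces the square root of a
    (1 - a) by an affine function of a with free weights. *)
Lemma deviation_le kap a M (th be : R) : 0 <= a <= 1 -> 0 <= M -> 0 <= th -> 0 <= be ->
  M ^+ 2 <= kap * (a * (1 - a)) -> kap <= 4 * th * be -> M <= th * a + be * (1 - a).
Proof.
move=> /andP[a0 a1] M0 th0 be0 HM Hk.
have a1' : 0 <= 1 - a by lra.
rewrite -ler_sqr ?nnegrE ?addr_ge0 ?mulr_ge0//.
apply: le_trans HM _.
apply: le_trans (ler_wpM2r _ Hk) _; first by rewrite mulr_ge0.
rewrite -subr_ge0 (_ : _ - _ = (th * a - be * (1 - a)) ^+ 2) ?sqr_ge0//; ring.
Qed.

(** Weights th = eps/2, be = eps: the share th a of M and v a <= (eps/2) a add up to eps a, leaving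
    eps (1 - a). *)
Lemma mixture_le_half kap eps : 0 < eps -> kap <= 2 * eps ^+ 2 ->
  mixture_le kap (eps / 2) eps.
Proof.
move=> e0 Hk a M v a01 M0 HM /andP[v0 vp].
have := @deviation_le kap a M (eps / 2) eps a01 M0; case/andP: a01 => a0 a1.
have -> : 4 * (eps / 2) * eps = 2 * eps ^+ 2 by field.
move=> /(_ _ _ HM Hk) h.
have {}h : M <= eps / 2 * a + eps * (1 - a) by apply: h; lra.
have h1 : v * a <= eps / 2 * a by rewrite ler_wpM2r.
have h2 : 0 <= v * M by rewrite mulr_ge0.
lra.
Qed.

(** The same balance with th = eps/4, to match v a <= (3 eps / 4) a. *)
Lemma mixture_le_quarter kap eps : 0 < eps -> kap <= eps ^+ 2 ->
  mixture_le kap (3 * eps / 4) eps.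
Proof.
move=> e0 Hk a M v a01 M0 HM /andP[v0 vp].
have := @deviation_le kap a M (eps / 4) eps a01 M0; case/andP: a01 => a0 a1.
have -> : 4 * (eps / 4) * eps = eps ^+ 2 by field.
move=> /(_ _ _ HM Hk) h.
have {}h : M <= eps / 4 * a + eps * (1 - a) by apply: h; lra.
have h1 : v * a <= 3 * eps / 4 * a by rewrite ler_wpM2r.
have h2 : 0 <= v * M by rewrite mulr_ge0.
lra.
Qed.

(** If a <= M, the mixture is at most M <= 3/4 <= 1 - eps. Otherwise it increases with v, and at v =
    1 - 2 eps the weights 1/2 and 3/2 bound it by (1 - eps) a + 3 eps (1 - a). Both cases use eps <=
    1/4. *)
Lemma mixture_le_large kap eps : 0 < eps -> eps <= 4^-1 -> kap <= 9 / 4 ->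
  mixture_le kap (1 - 2 * eps) (1 - eps).
Proof.
move=> e0 e1 Hk a M v a01 M0 HM /andP[v0 vp].
have [aM|Ma] := leP a M.
  have := @deviation_le kap a M (3 / 4) (3 / 4) a01 M0.
  have -> : 4 * (3 / 4) * (3 / 4) = 9 / 4 :> R by field.
  move=> /(_ _ _ HM Hk) h.
  have {}h : M <= 3 / 4 * a + 3 / 4 * (1 - a) by apply: h; lra.
  have : v * a <= v * M by rewrite ler_wpM2l.
  lra.
have := @deviation_le kap a M (1 / 2) (3 / 2) a01 M0; case/andP: a01 => a0 a1.
have -> : 4 * (1 / 2) * (3 / 2) = 3 :> R by field.
move=> /(_ _ _ HM) h.
have {}h : M <= 1 / 2 * a + 3 / 2 * (1 - a) by apply: h; lra.
have h1 : 0 <= (1 - 2 * eps - v) * (a - M) by rewrite mulr_ge0; lra.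
have h2 : eps * M <= eps * (1 / 2 * a + 3 / 2 * (1 - a)) by rewrite ler_pM2l.
have h3 : eps * (1 - a) <= 4^-1 * (1 - a) by rewrite ler_wpM2r//; lra.
have h4 : 0 <= eps * a by rewrite mulr_ge0// ltW.
have h5 : (1 - 2 * eps) * a + 2 * (eps * M) <= 1 - eps by lra.
lra.
Qed.

Lemma expR_rate_bound (s : R) (k : nat) q : 0 < q -> k%:R * ln (1 / q) <= s ->
  expR (- s) <= q ^+ k.
Proof.
move=> q0 h; rewrite -[q in X in _ <= X]lnK ?posrE// -expRM_natl ler_expR.
by move: h; rewrite div1r lnV ?posrE//; lra.
Qed.

(** The value 16/3 is what makes 12 e^(-2) at most 9/4; (1 + 1/4)^8 already exceeds it. *)
Lemma expR2_ge : 16 / 3 <= expR 2 :> R.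
Proof.
have -> : (2 : R) = 8%:R * (1 / 4) by field.
rewrite expRM_natl; have := expR_ge1Dx (1 / 4 : R) => h.
apply: le_trans (_ : (1 + 1 / 4) ^+ 8 <= _); first lra.
by apply: lerXn2r => //; rewrite nnegrE ?expR_ge0//; lra.
Qed.

(** [S1] must be nonempty, as [inf] takes a default value on the empty set; this is why times
    reaching each level have to be exhibited. *)
Lemma inf_le_shift (S1 S2 : set R) c : S1 !=set0 -> has_lbound S2 ->
  (forall t, S1 t -> S2 (t + c)) -> inf S2 <= inf S1 + c.
Proof.
move=> S10 lb H; rewrite -lerBlDr; apply: lb_le_inf => // t S1t.
by rewrite lerBlDr; apply: ge_inf => //; exact: H.
Qed.

Lemma exists_expR_le (del r : R) : 0 < del -> 0 < r ->
  exists t : nat, expR (- (2 * t%:R / r)) <= del.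
Proof.
move=> d0 r0; exists (Num.bound (`|ln del| * r)).
rewrite -[del in X in _ <= X]lnK ?posrE// ler_expR lerNl.
apply: le_trans (_ : `|ln del| <= _); first by rewrite -normrN ler_norm.
rewrite ler_pdivlMr//; have h : 0 <= `|ln del| * r by rewrite mulr_ge0// ltW.
by have := archi_boundP h; lra.
Qed.

End Numerics.

(** * Mixing times: existence, upper bounds and lower bounds *)

Section Mixing.
Context {R : realType} {n : nat}.
Variables (P : 'M[R]_n) (pi : 'rV[R]_n).
Hypotheses (n_ge2 : (2 <= n)%N) (sP : stochastic P) (statP : stationary P pi)
  (iP : irreducible P) (rP : reversible P pi) (lP : lazy P).
Implicit Types (A : {set 'I_n}) (eps : R).

Let pi_gt0 x : 0 < pi 0 x. Proof. exact: irreducible_pi_gt0 sP statP iP. Qed.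
Let pi_ge0 x : 0 <= pi 0 x. Proof. exact: ltW. Qed.
Let dpi : distribution_vec pi. Proof. by case: statP. Qed.
Let trel0 : 0 < trel P. Proof. exact: trel_gt0 n_ge2 sP statP iP rP lP. Qed.
Let psdP f : 0 <= ip pi (P *m f) f. Proof. exact: lazy_psd. Qed.

Lemma pi_lower_bound : exists2 c : R, 0 < c & forall x, c <= pi 0 x.
Proof.
have x0 : 'I_n by exact: Ordinal n_ge2.
have [x _ Hx] := arg_minP (fun x => pi 0 x) (isT : xpredT x0).
by exists (pi 0 x) => // y; exact: Hx.
Qed.

(** Bounds the value at x by the L^2 norm, at the price of a factor 1 / pi(x). This crude estimate
    serves only to show that mixing times are finite. *)
Lemma tv_le_of_contraction (K : 'M[R]_n) (rho2 r : R) : stochastic K -> 0 <= r ->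
  (forall e, mean pi e = 0 -> ip pi (K *m e) (K *m e) <= rho2 * ip pi e e) ->
  0 <= rho2 -> (forall x, rho2 <= pi 0 x * r ^+ 2) ->
  forall x, tv_dist (row x K) pi <= r.
Proof.
move=> sK r0 contr rho0 Hr x; apply: tv_dist_le => // A.
have [e0 ee] := ip_centered_indic dpi A; set e := indic A - _ in e0 ee.
have -> : mass pi A - mass (row x K) A = - (K *m e) x 0.
  rewrite mass_row /e mulmxBr const_mxZ -scalemxAr stochastic_one//.
  set b := K *m indic A; rewrite -opprB; congr (- _).
  by rewrite [RHS]mxE [X in _ = _ + X]mxE [X in _ = _ - X]mxE [const_mx _ _ _]mxE mulr1.
apply: le_trans (ler_norm _) _; rewrite normrN.
rewrite -ler_sqr ?nnegrE// real_normK ?num_real// -(ler_pM2l (pi_gt0 x)).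
apply: le_trans (Hr x); apply: le_trans (_ : ip pi (K *m e) (K *m e) <= _).
  rewrite /ip (bigD1 x)//= expr2 lerDl; apply: sumr_ge0 => y _.
  by rewrite mulr_ge0// -expr2 sqr_ge0.
apply: le_trans (contr _ e0) _; rewrite ee ler_piMr//.
have := mass_ge0 A dpi; have := mass_le1 A dpi; nra.
Qed.

Lemma dist_mix_leP t (r : R) : 0 <= r ->
  dist_mix P pi t <= r <-> forall x, tv_dist (row x (P ^+ t)) pi <= r.
Proof.
move=> r0; split=> [h x|h]; last exact: bigmax_le.
by apply: le_trans h; exact: (le_bigmax _ (fun x => tv_dist (row x (P ^+ t)) pi) x).
Qed.

Lemma dist_mix_ct_leP (t r : R) : 0 <= r ->
  dist_mix_ct P pi t <= r <-> forall x, tv_dist (row x (heat_kernel P t)) pi <= r.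
Proof.
move=> r0; split=> [h x|h]; last exact: bigmax_le.
by apply: le_trans h; exact: (le_bigmax _ (fun x => tv_dist (row x (heat_kernel P t)) pi) x).
Qed.

Lemma exists_dist_mix_le (r : R) : 0 < r -> exists t : nat,
  dist_mix P pi t <= r /\ dist_mix_ct P pi t%:R <= r.
Proof.
move=> r0; have [c c0 cpi] := pi_lower_bound.
have [t Ht] := exists_expR_le (mulr_gt0 c0 (exprn_gt0 2 r0)) trel0; exists t.
have Hx x : expR (- (2 * t%:R / trel P)) <= pi 0 x * r ^+ 2.
  by apply: le_trans Ht _; rewrite ler_wpM2r ?sqr_ge0.
split.
  apply/dist_mix_leP; first exact: ltW.
  apply: (tv_le_of_contraction _ (ltW r0) _ (expR_ge0 _) Hx).
    exact: stochasticX.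
  by move=> e; exact: (power_contraction n_ge2 sP statP iP rP lP).
apply/dist_mix_ct_leP; first exact: ltW.
apply: (tv_le_of_contraction _ (ltW r0) _ (expR_ge0 _) Hx).
  by apply: (heat_stochastic sP statP iP rP).
by move=> e; exact: (heat_contraction n_ge2 sP statP iP rP lP).
Qed.

Lemma dist_mix_le_of_avoid (alpha m2 p r : R) tau t : 0 <= r ->
  0 < m2 -> 6 / m2 <= 1 - alpha ->
  (forall x A, alpha <= mass pi A -> avoid P A tau x 0 <= p) ->
  mixture_le (m2 * expR (- (2 * t%:R / trel P))) p r ->
  dist_mix P pi (tau + t) <= r.
Proof.
move=> r0 m20 Hm2 Hav Hnum; apply/dist_mix_leP => // x.
rewrite exprD -[_ * _]/(_ *m _).
apply: (tv_le_of_avoid pi_gt0 dpi sP rP psdP _ m20 Hm2 _ Hav Hnum).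
  exact: stochasticX.
by move=> e; exact: (power_contraction n_ge2 sP statP iP rP lP).
Qed.

Lemma mean_avoid_half Q A (lam gam : R) k : stochastic Q -> reversible Q pi ->
  (forall f, 0 <= ip pi (Q *m f) f) ->
  (forall f, mean pi f = 0 -> ip pi (Q *m f) f <= lam * ip pi f f) -> lam <= 1 ->
  1 / 2 <= mass pi A -> 0 < gam -> (1 + lam) / 2 <= gam ->
  mean pi (avoid Q A k) <= gam ^+ k / 2.
Proof.
move=> sQ rQ psdQ gap lam1 HA gam0 Hgam.
apply: (mean_avoid_le pi_gt0 dpi sQ rQ psdQ (lam := lam) (beta := 2^-1)) => //; lra.
Qed.

Lemma avoid_le_of_dist_mix (r eps : R) t s A x : 0 <= r -> 0 < eps -> eps <= 1 ->
  dist_mix P pi t <= r -> 2 * trel P * `|ln eps| <= s%:R -> 1 / 2 <= mass pi A ->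
  avoid P A (t + s) x 0 <= r + eps / 2.
Proof.
move=> r0 e0 e1 /(dist_mix_leP _ r0)/(_ x) Ht Hs HA.
apply: le_trans (avoid_add_le _ _ _ _ sP) _.
rewrite -mean_row.
apply: le_trans (tv_dist_test (nu := pi) _ _ _) _ => //.
- exact: stochasticX.
- by move=> y; exact: avoid_bound.
rewrite addrC; apply: lerD => //.
(* By exp(-z) >= 1 - z with z = (1 - lambda2) / 2, this rate dominates (1 + lambda2) / 2. *)
pose gam := expR (- (1 / (2 * trel P))).
have [V [d Vunit VP]] := reversible_diag pi_gt0 rP.
have l1 := lambda2_lt1 n_ge2 sP statP iP rP lP Vunit VP.
apply: le_trans (mean_avoid_half s (lam := lambda2 P) (gam := gam) sP rP psdP _ (ltW l1) HA _ _) _.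
- by move=> f mf; have := power_gap n_ge2 sP statP iP rP lP 1 mf; rewrite !expr1.
- exact: expR_gt0.
- have := expR_ge1Dx (- (1 / (2 * trel P))); rewrite -/gam => h.
  have E : 1 / (2 * trel P) = (1 - lambda2 P) / 2.
    by rewrite -trel_lambda2; field; rewrite gt_eqF.
  by rewrite E in h; lra.
rewrite ler_pM2r// /gam -expRM_natl -[eps in X in _ <= X]lnK ?posrE//.
rewrite ler_expR mulrN lerNl; apply: le_trans (_ : `|ln eps| <= _).
  by rewrite -normrN ler_norm.
rewrite mulrA mulr1 ler_pdivlMr ?mulr_gt0//; lra.
Qed.

(** Compare the means of f under the row of K and under pi, at a state where |f| is largest. *)
Lemma eigen_lower (K : 'M[R]_n) (f : 'cV[R]_n) (l r : R) : f != 0 ->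
  mean pi f = 0 -> K *m f = l *: f -> 0 <= l ->
  (forall x, tv_dist (row x K) pi <= r) -> l <= 2 * r.
Proof.
move=> f0 mf Kf l0 Hr.
have x0 : 'I_n by exact: Ordinal n_ge2.
have [x _ Hx] := arg_maxP (fun x => `|f x 0|) (isT : xpredT x0).
have fx0 : 0 < `|f x 0|.
  rewrite lt_neqAle normr_ge0 andbT eq_sym; apply: contra f0 => /eqP fx.
  apply/eqP/matrixP => y j; rewrite ord1 [RHS]mxE; apply/eqP; rewrite -normr_le0.
  by rewrite -fx; exact: Hx.
have := @tv_dist_mean R n (row x K) pi f `|f x 0| (fun y => Hx y isT).
rewrite mean_row mf subr0 Kf mxE normrM (ger0_norm l0) => h.
rewrite -(ler_pM2r fx0); apply: le_trans h _.
by rewrite mulrAC ler_pM2r// ler_pM2l.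
Qed.

(** The eigenfunction gives lambda2^t <= 2 eps. Then - ln l <= (1 - l) / l is applied, and l / (1 -
    l) = t_rel - 1 explains the subtracted 1. *)
Lemma dist_mix_trel eps t : 0 < eps -> eps <= 4^-1 -> dist_mix P pi t <= eps ->
  (trel P - 1) * `|ln (2 * eps)| <= t%:R.
Proof.
move=> e0 e1 /(dist_mix_leP _ (ltW e0)) Ht.
have [V [d Vunit VP]] := reversible_diag pi_gt0 rP.
have [f [f0 Pf mf]] := lambda2_eigen n_ge2 sP statP iP rP lP Vunit VP.
have l1 := lambda2_lt1 n_ge2 sP statP iP rP lP Vunit VP.
have l0 := lambda2_ge0 n_ge2 sP statP iP rP lP Vunit VP.
have Ptf : P ^+ t *m f = lambda2 P ^+ t *: f.
  by rewrite -(fcX Vunit VP) (fc_eigen Vunit VP (fun z => z ^+ t) Pf).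
have := eigen_lower f0 mf Ptf (exprn_ge0 _ l0) Ht.
rewrite /trel; set l := lambda2 P in l0 l1 * => h.
(* At l = 0 the logarithm carries no information, but then t_rel = 1 and the left-hand side is 0. *)
have [lz|lnz] := eqVneq l 0; first by rewrite lz subr0 invr1 subrr mul0r.
have lp : 0 < l by rewrite lt_neqAle eq_sym lnz.
have -> : (1 - l)^-1 - 1 = l / (1 - l) by field; rewrite gt_eqF ?subr_gt0.
have ln2 : ln (2 * eps) <= 0 by apply: ln_le0; lra.
rewrite ler0_norm//.
have h1 : t%:R * ln l <= ln (2 * eps).
  rewrite mulr_natl -lnXn// ler_ln ?posrE// ?exprn_gt0//; lra.
have h2 : 0 <= t%:R * (ln l + (1 - l) / l).
  rewrite mulr_ge0//; have := @le_ln1Dx R (l^-1 - 1).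
  have -> : 1 + (l^-1 - 1) = l^-1 by ring.
  rewrite lnV ?posrE// => hl.
  have E : (1 - l) / l = l^-1 - 1 by field.
  have : 0 < l^-1 by rewrite invr_gt0.
  rewrite E => li; have := hl _; lra.
have h3 : - ln (2 * eps) <= t%:R * ((1 - l) / l) by lra.
have c0 : 0 <= l / (1 - l) by rewrite divr_ge0// subr_ge0 ltW.
apply: le_trans (ler_wpM2l c0 h3) _.
rewrite le_eqVlt; apply/orP; left; apply/eqP; field.
by rewrite lnz gt_eqF ?subr_gt0.
Qed.

Lemma dist_mix_ct_trel eps t : 0 < eps -> eps <= 4^-1 -> 0 <= t ->
  dist_mix_ct P pi t <= eps -> (trel P - 1) * `|ln (2 * eps)| <= t.
Proof.
move=> e0 e1 t0 /(dist_mix_ct_leP _ (ltW e0)) Ht.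
have [f [f0 Pf mf Hf]] := heat_lambda2_eigen n_ge2 sP statP iP rP lP.
have := eigen_lower f0 mf (Hf t) (expR_ge0 _) Ht.
rewrite -[2 * eps in X in X -> _]lnK ?posrE ?mulr_gt0// ler_expR => h.
have ln2 : ln (2 * eps) <= 0 by apply: ln_le0; lra.
rewrite ler0_norm//; apply: le_trans (_ : trel P * - ln (2 * eps) <= _).
  by rewrite ler_wpM2r; lra.
by rewrite mulrC -ler_pdivlMr//; lra.
Qed.

End Mixing.

(** * Continuous hitting times through dyadic grids *)

Section ContinuousHitting.
Context {R : realType} {n : nat} {d : measure_display} {T : measurableType d}.
Implicit Types (A : {set 'I_n}) (X : R -> T -> 'I_n).

(** The grid contains both endpoints t and t + s; the offset t leaves time to mix before A is
    watched. *)
Definition grid_avoid X A (t s : R) (m : nat) : set T :=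
  [set w | forall i, (i <= m)%N -> X (t + i%:R * (s / m%:R)) w \notin A].

Lemma hitting_time_ct_gt_sub X A (t s : R) m : 0 <= t -> 0 <= s -> (0 < m)%N ->
  [set w | ((t + s)%:E < hitting_time_ct X A w)%E] `<=` grid_avoid X A t s m.
Proof.
move=> t0 s0 m0 w /= h i im; apply/negP => XA; move: h; apply/negP; rewrite -leNgt.
have m0' : 0 < m%:R :> R by rewrite ltr0n.
have is0 : 0 <= i%:R * (s / m%:R) by rewrite mulr_ge0// divr_ge0.
apply: (@le_trans _ _ ((t + i%:R * (s / m%:R))%:E)); last first.
  rewrite lee_fin lerD2l mulrCA ler_piMr// ler_pdivrMr// mul1r ler_nat//.
by apply: ereal_inf_lbound; exists (t + i%:R * (s / m%:R)) => //; split => //; rewrite addr_ge0.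
Qed.

(* A path that hits A by time t is in A at time t, or stays in A for a while
   after some earlier time, hence is in A at a point of some dyadic grid. *)
Lemma hitting_time_ct_gtE X A (t : R) : 0 <= t ->
  (forall w (t : R), 0 <= t -> \forall s \near t^'+, X s w = X t w) ->
  [set w | (t%:E < hitting_time_ct X A w)%E] =
  \bigcap_N grid_avoid X A 0 t (2 ^ N).
Proof.
move=> t0 rc; apply/seteqP; split => [w h N _|w h /=].
  by apply: hitting_time_ct_gt_sub; rewrite ?add0r// expn_gt0.
rewrite ltNge; apply/negP => hle.
have no_hit s : 0 <= s -> s <= t -> X s w \notin A.
  move=> s0; rewrite le_eqVlt => /orP[/eqP ->|st].
    by have := h 0%N I 1%N (leqnn _); rewrite add0r mul1r divr1.
  have := rc w s s0 => -[e /= e0 He].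
  have t_gt0 : 0 < t by exact: le_lt_trans st.
  pose e' := Num.min e (t - s).
  have e'0 : 0 < e' by rewrite lt_min e0 subr_gt0.
  pose N := Num.bound (t / e').
  have tN : t / (2 ^ N)%:R < e'.
    rewrite ltr_pdivrMr ?ltr0n ?expn_gt0// mulrC -ltr_pdivrMr//.
    have := archi_boundP (divr_ge0 t0 (ltW e'0)) => /lt_trans; apply.
    by rewrite ltr_nat; exact: ltn_expl.
  pose del := t / (2 ^ N)%:R.
  have del0 : 0 < del by rewrite divr_gt0// ltr0n expn_gt0.
  have sd0 : 0 <= s / del by rewrite divr_ge0// ltW.
  (* [k * del] is the first grid point strictly after s. It is at most s + del < s + e', hence
     before t and where the path still agrees with its value at s. *)
  pose k := (Num.truncn (s / del)).+1.
  have /andP[k1 k2] := Num.Theory.truncn_itv sd0.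
  have sk : s < k%:R * del by rewrite -ltr_pdivrMr.
  have ks : k%:R * del <= s + del.
    move: k1; rewrite ler_pdivlMr// => k1.
    by rewrite /k -natr1 mulrDl mul1r lerD2r.
  have kt : (k <= 2 ^ N)%N.
    rewrite -(ler_nat R) -(ler_pM2r del0).
    have -> : (2 ^ N)%:R * del = t by rewrite /del mulrC divfK// gt_eqF// ltr0n expn_gt0.
    have : e' <= t - s by rewrite ge_min lexx orbT.
    by rewrite -/del in tN; lra.
  have := h N I k kt; rewrite add0r -/del => hk.
  rewrite -(He (k%:R * del))//=.
  rewrite ltr_norml.
  have : e' <= e by rewrite ge_min lexx.
  rewrite -/del in tN => ee; apply/andP; split; lra.
move: hle; apply/negP; rewrite -ltNge.
have S_gt z : [set t%:E | t in [set t : R | 0 <= t /\ X t w \in A]] z -> (t%:E < z)%E.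
  move=> [s [s0 sA] <-]; rewrite lte_fin ltNge; apply/negP => /(no_hit s s0).
  by rewrite sA.
(* The absence of visits up to t only gives an infimum >= t; right-continuity at t keeps the path
   off A a little longer and makes it strict. *)
have := rc w t t0 => -[e /= e0 He].
apply: (@lt_le_trans _ _ (t + e)%:E); first by rewrite lte_fin ltrDl.
apply: le_ereal_inf_tmp => z Sz; have := S_gt z Sz.
move: Sz => [s [s0 sA] <-]; rewrite lte_fin lee_fin => ts.
rewrite leNgt; apply/negP => ste.
have : X s w = X t w by apply: He => //=; rewrite ltr_norml; apply/andP; split; lra.
by move=> E; have := no_hit t t0 (lexx t); rewrite -E sA.
Qed.

Variables (P : 'M[R]_n) (pi : 'rV[R]_n).
Hypotheses (n_ge2 : (2 <= n)%N) (sP : stochastic P) (statP : stationary P pi)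
  (iP : irreducible P) (rP : reversible P pi) (lP : lazy P).
Variables (Pr : 'I_n -> probability T R) (X : R -> T -> 'I_n).
Hypothesis mcX : markov_chain_ct P Pr X.

Lemma measurable_grid_avoid A t s m : 0 <= t -> 0 <= s ->
  measurable (grid_avoid X A t s m).
Proof.
case: mcX => mX _ _ t0 s0; apply: measurable_forall_le => i.
apply: (measurable_preim_pred (fun z => z \notin A)) => z; apply: mX.
by rewrite addr_ge0// mulr_ge0// divr_ge0.
Qed.

(** The finite-dimensional laws start at time 0, so 0 is prepended to the grid and the state there
    summed out; this turns row x of H_t into the initial law of the sampled chain. *)
Lemma grid_avoid_law x A t s m : 0 <= t -> 0 <= s ->
  Pr x (grid_avoid X A t s m) =
  ((heat_kernel P t *m avoid (heat_kernel P (s / m%:R)) A m) x 0)%:E.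
Proof.
case: mcX => mX _ law t0 s0; set del := s / m%:R.
have del0 : 0 <= del by rewrite divr_ge0.
pose Y i := X (t + i%:R * del).
have time0 i : 0 <= t + i%:R * del by rewrite addr_ge0// mulr_ge0.
have mY i z : measurable (Y i @^-1` [set z]) by exact: mX.
rewrite (@avoid_law _ _ _ _ (Pr x) Y (fun y => heat_kernel P t x y) (heat_kernel P del)) //.
  by rewrite mxE.
move=> k y; rewrite (measure_partition _ (Z := X 0)) => [||z]; last exact: mX; last first.
  by apply: measurable_forall_le => i; exact: mY.
pose tt i : R := if i is i'.+1 then t + i'%:R * del else 0.
pose yy z i : 'I_n := if i is i'.+1 then y i' else z.
have E z : Pr x ([set w | forall i, (i <= k)%N -> Y i w = y i] `&` X 0 @^-1` [set z]) =
   ((z == x)%:R * (heat_kernel P t z (y 0%N) *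
      \prod_(i < k) heat_kernel P del (y i) (y i.+1)))%:E.
  have := law x k.+1 tt (yy z) erefl.
  rewrite big_ord_recl /= mul0r addr0 subr0.
  rewrite (eq_bigr (fun i : 'I_k => heat_kernel P del (y i) (y i.+1))); last first.
    move=> i _; rewrite /bump leq0n add1n /=; congr (heat_kernel P _ _ _).
    by rewrite -natr1; ring.
  move=> <-; last first.
    move=> [|i] ik; first by rewrite /= mul0r addr0.
    by rewrite /= lerD2l ler_wpM2r// ler_nat.
  congr (Pr x _); apply/seteqP; split => w /=.
    by move=> [h1 h2] [|i] ik //=; exact: h1.
  by move=> h; split=> [i ik|]; [exact: (h i.+1)|exact: (h 0%N)].
rewrite (eq_bigr _ (fun z _ => E z)).
rewrite sumEFin; congr (_%:E); rewrite (bigD1 x)//= eqxx mul1r [X in _ + X]big1 ?addr0// => z zx.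
by rewrite (negbTE zx) mul0r.
Qed.

Definition hit_prob x A (t : R) : R := fine (Pr x [set w | (t%:E < hitting_time_ct X A w)%E]).

Lemma measurable_hitting_time_ct A t : 0 <= t ->
  measurable [set w | (t%:E < hitting_time_ct X A w)%E].
Proof.
move=> t0; case: (mcX) => _ rc _; rewrite hitting_time_ct_gtE//.
by apply: bigcapT_measurable => N; exact: measurable_grid_avoid.
Qed.

Lemma hit_prob_le_grid x A t s m : 0 <= t -> 0 <= s -> (0 < m)%N ->
  hit_prob x A (t + s) <=
  (heat_kernel P t *m avoid (heat_kernel P (s / m%:R)) A m) x 0.
Proof.
move=> t0 s0 m0; rewrite -lee_fin -grid_avoid_law// /hit_prob fineK; last first.
  by apply: fin_num_measure; apply: measurable_hitting_time_ct; rewrite addr_ge0.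
apply: le_measure; rewrite ?inE.
- by apply: measurable_hitting_time_ct; rewrite addr_ge0.
- exact: measurable_grid_avoid.
- exact: hitting_time_ct_gt_sub.
Qed.

Lemma avoid_dyadic_cvg x A t : 0 <= t ->
  avoid (heat_kernel P (t / (2 ^ N)%:R)) A (2 ^ N) x 0 @[N --> \oo] --> hit_prob x A t.
Proof.
move=> t0; case: (mcX) => _ rc _.
have E N : Pr x (grid_avoid X A 0 t (2 ^ N)) =
    (avoid (heat_kernel P (t / (2 ^ N)%:R)) A (2 ^ N) x 0)%:E.
  by rewrite grid_avoid_law// (heat_kernel0 sP statP iP rP) mul1mx.
have mh := measurable_hitting_time_ct A t0.
have fh : hit_prob x A t = fine (Pr x (\bigcap_N grid_avoid X A 0 t (2 ^ N))).
  by rewrite /hit_prob hitting_time_ct_gtE.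
rewrite fh (_ : (fun N => _) = fine \o (Pr x \o (fun N => grid_avoid X A 0 t (2 ^ N)))).
  2: by apply/funext => N /=; rewrite E.
apply: fine_cvg; rewrite fineK; last first.
  by rewrite -hitting_time_ct_gtE//; exact: fin_num_measure.
apply: nonincreasing_cvg_mu.
- by apply: le_lt_trans (ltry 1); apply: probability_le1; exact: measurable_grid_avoid.
- by move=> N; exact: measurable_grid_avoid.
- by rewrite -hitting_time_ct_gtE.
(* Nested grids: point i at level N is point 2i at level N + 1. *)
apply/nonincreasing_seqP => N; apply/subsetPset => w h i iN.
have := h (2 * i)%N; rewrite expnS leq_mul2l iN => /(_ isT).
have -> : (2 * i)%:R * (t / (2 * 2 ^ N)%:R) = i%:R * (t / (2 ^ N)%:R) :> R => //.
rewrite !natrM; field; by rewrite pnatr_eq0 expn_eq0.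
Qed.

Lemma p_hit_ct_leP x (alpha t eps : R) : 0 <= eps ->
  p_hit_ct pi Pr X x alpha t <= eps <->
  forall A, alpha <= mass pi A -> hit_prob x A t <= eps.
Proof.
move=> e0; split=> [h A HA|h]; last exact: bigmax_le.
apply: le_trans h.
exact: (le_bigmax_cond _ (P := fun A : {set 'I_n} => alpha <= mass pi A)
    (fun A => hit_prob x A t) HA).
Qed.

Let pi_gt0 x : 0 < pi 0 x. Proof. exact: irreducible_pi_gt0 sP statP iP. Qed.
Let dpi : distribution_vec pi. Proof. by case: statP. Qed.
Let trel0 : 0 < trel P. Proof. exact: trel_gt0 n_ge2 sP statP iP rP lP. Qed.

(** There are finitely many pairs (x, A), so one dyadic level brings all the grid probabilities
    below p + e. The discrete argument at that level gives r + e, with e arbitrary. *)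
Lemma dist_mix_ct_le_of_hit (alpha m2 p r tau t : R) : 0 <= r -> 0 <= p ->
  0 <= tau -> 0 <= t -> 0 < m2 -> 6 / m2 <= 1 - alpha ->
  (forall x, p_hit_ct pi Pr X x alpha tau <= p) ->
  mixture_le (m2 * expR (- (2 * t / trel P))) p r ->
  dist_mix_ct P pi (tau + t) <= r.
Proof.
move=> r0 p0 tau0 t0 m20 Hm2 Hhit Hnum; apply/dist_mix_ct_leP => // x.
apply/ler_addgt0Pr => e e0.
have [N HN] : exists N, forall xA : 'I_n * {set 'I_n}, alpha <= mass pi xA.2 ->
    avoid (heat_kernel P (tau / (2 ^ N)%:R)) xA.2 (2 ^ N) xA.1 0 <= p + e.
  have : \forall N \near \oo, forall xA : 'I_n * {set 'I_n}, alpha <= mass pi xA.2 ->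
    avoid (heat_kernel P (tau / (2 ^ N)%:R)) xA.2 (2 ^ N) xA.1 0 <= p + e.
    apply: filter_forall => -[y A]; have [HA|nHA] := boolP (alpha <= mass pi A); last first.
      by apply: nearW => N.
    have hp := (p_hit_ct_leP _ _ _ p0).1 (Hhit y) A HA.
    have lt : hit_prob y A tau < p + e by apply: le_lt_trans hp _; rewrite ltrDl.
    have near_le := cvgr_le _ (@avoid_dyadic_cvg y A tau tau0) _ lt.
    by near=> N => _; near: N; exact: near_le.
  by case=> N _ /(_ N (leqnn N)); exists N.
set del := tau / (2 ^ N)%:R in HN *.
have del0 : 0 <= del by rewrite divr_ge0.
have -> : heat_kernel P (tau + t) = heat_kernel P del ^+ (2 ^ N) *m heat_kernel P t.
  have tauE : (2 ^ N)%:R * del = tau.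
    by rewrite /del mulrC divfK// pnatr_eq0 expn_eq0.
  by rewrite (heat_kernelX sP statP iP rP) tauE (heat_kernelD sP statP iP rP).
have sD := heat_stochastic sP statP iP rP del0.
have rD := heat_reversible sP statP iP rP del.
have psdD := heat_psd sP statP iP rP del.
apply: (tv_le_of_avoid pi_gt0 dpi sD rD psdD _ m20 Hm2 _
  (fun y A HA => HN (y, A) HA) (mixture_leS p0 (ltW e0) Hnum)).
  exact: (heat_stochastic sP statP iP rP).
by move=> f; exact: (heat_contraction n_ge2 sP statP iP rP lP).
Unshelve. all: by end_near. Qed.

(** A grid step killed on a set of mass 1/2 contracts by (1 + e^(-u)) / 2, not by e^(-u/2); the
    correction is quadratic in u, so it disappears over m steps when m u is fixed and m grows. *)
Lemma half_mass_decay_rate (u : R) : 0 <= u ->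
  (1 + expR (- u)) / 2 <= expR (- (u / 2) + u ^+ 2 / 2).
Proof.
move=> u0; apply: le_trans (expR_ge1Dx _).
have : expR (- u) <= 1 - u + u ^+ 2; last by lra.
rewrite expRN -div1r ler_pdivrMr ?expR_gt0//.
have h := expR_ge1Dx u.
have h1 : 0 <= 1 - u + u ^+ 2 by nra.
by apply: le_trans (ler_wpM2l h1 h); rewrite expr2; nra.
Qed.

Lemma hit_prob_le_of_dist_mix (r eps t : R) A x : 0 <= r -> 0 < eps -> eps <= 1 ->
  0 <= t -> dist_mix_ct P pi t <= r -> 1 / 2 <= mass pi A ->
  hit_prob x A (t + 2 * trel P * `|ln eps|) <= r + eps / 2.
Proof.
move=> r0 e0 e1 t0 /(dist_mix_ct_leP _ _ _ r0)/(_ x) Ht HA.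
set l := `|ln eps|; set s := 2 * trel P * l.
have l0 : 0 <= l by exact: normr_ge0.
have s0 : 0 <= s by rewrite !mulr_ge0// ltW.
have bound m : (0 < m)%N ->
    hit_prob x A (t + s) <= r + eps / 2 * expR (2 * l ^+ 2 / m%:R).
  move=> m0; apply: le_trans (hit_prob_le_grid x A t0 s0 m0) _.
  have m0' : 0 < m%:R :> R by rewrite ltr0n.
  set del := s / m%:R; have del0 : 0 <= del by rewrite divr_ge0.
  pose u := 2 * l / m%:R.
  have u0 : 0 <= u by rewrite divr_ge0// mulr_ge0.
  have uE : del / trel P = u by rewrite /del /u /s; field; rewrite !gt_eqF.
  have sD := heat_stochastic sP statP iP rP del0.
  rewrite -mean_row; apply: le_trans (tv_dist_test (nu := pi) _ _ _) _ => //.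
  - exact: (heat_stochastic sP statP iP rP).
  - by move=> y; exact: avoid_bound.
  rewrite addrC; apply: lerD => //.
  apply: le_trans (mean_avoid_half sP statP iP m (lam := expR (- u)) sD
    (heat_reversible sP statP iP rP del) (heat_psd sP statP iP rP del) _ _ HA
    (expR_gt0 _) (half_mass_decay_rate u0)) _.
  - by move=> f mf; rewrite -uE; exact: (heat_gap n_ge2 sP statP iP rP lP).
  - by rewrite -expR0 ler_expR oppr_le0.
  rewrite -expRM_natl.
  have -> : m%:R * (- (u / 2) + u ^+ 2 / 2) = - l + 2 * l ^+ 2 / m%:R.
    by rewrite /u; field; rewrite gt_eqF.
  have -> : - l = ln eps by rewrite /l ler0_norm ?opprK// ln_le0.
  by rewrite expRD lnK ?posrE// mulrAC.
apply/ler_addgt0Pr => e e_gt0.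
(* The slack e is eps/2 times a relative error h. The grid size makes v = 2 l^2 / m at most h / (1 +
   h), whence exp(v) <= 1 / (1 - v) <= 1 + h. *)
pose h := e / (eps / 2); have h0 : 0 < h by rewrite !divr_gt0.
pose m := (Num.bound (2 * l ^+ 2 * (1 + h) / h)).+1.
have := bound m isT => /le_trans; apply.
rewrite -addrA lerD2l.
have -> : eps / 2 + e = eps / 2 * (1 + h) by rewrite /h; field; rewrite gt_eqF.
rewrite ler_pM2l ?divr_gt0//.
have m0 : 0 < m%:R :> R by rewrite ltr0n.
have l2 : 0 <= 2 * l ^+ 2 by rewrite mulr_ge0// sqr_ge0.
have mb : 2 * l ^+ 2 * (1 + h) / h < m%:R.
  have h2 : 0 <= 2 * l ^+ 2 * (1 + h) / h.
    by apply: divr_ge0; [apply: mulr_ge0 => //; lra | exact: ltW].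
  by apply: lt_trans (archi_boundP h2) _; rewrite ltr_nat.
set v := 2 * l ^+ 2 / m%:R.
have v_le : v <= h / (1 + h).
  rewrite /v ler_pdivrMr// mulrAC ler_pdivlMr; last lra.
  by move: mb; rewrite ltr_pdivrMr// => /ltW; rewrite [h * _]mulrC.
have h1 : 0 < 1 - v.
  have : h / (1 + h) < 1 by rewrite ltr_pdivrMr; lra.
  lra.
rewrite -[v]opprK expRN -div1r ler_pdivrMr ?expR_gt0//.
have h3 : 1 + - v <= expR (- v) by exact: expR_ge1Dx.
have h4 : 0 <= 1 + h by lra.
apply: le_trans (ler_wpM2l h4 h3).
have : v * (1 + h) <= h by rewrite -ler_pdivlMr//; lra.
lra.
Qed.

End ContinuousHitting.

(** * Assembly of the discrete and continuous bounds *)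

Section Bounds.
Context {R : realType} {n : nat}.
Variables (P : 'M[R]_n) (pi : 'rV[R]_n) (eps : R).
Hypotheses (n_ge2 : (2 <= n)%N) (sP : stochastic P) (statP : stationary P pi)
  (iP : irreducible P) (rP : reversible P pi) (lP : lazy P)
  (eps_gt0 : 0 < eps) (eps_le : eps <= 4^-1).

Let dpi : distribution_vec pi. Proof. by case: statP. Qed.
Let trel0 : 0 < trel P. Proof. exact: trel_gt0 n_ge2 sP statP iP rP lP. Qed.

Lemma ceilr_nat (a : R) : 0 <= a -> exists2 k : nat, ceilr a = k%:R & a <= k%:R.
Proof.
move=> a0; have h : (0 <= Num.ceil a)%R by rewrite ceil_ge0 (lt_le_trans _ a0)// ltrN10.
exists `|Num.ceil a|%N; first by rewrite /ceilr -[in LHS](gez0_abs h).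
by rewrite pmulrn gez0_abs// ceil_ge.
Qed.

Let ln4e0 : 0 <= ln (4 / eps).
Proof. by apply: ln_ge0; rewrite ler_pdivlMr//; move: eps_le; lra. Qed.

(** Used with k = 2, where 12 (eps/4)^2 <= 2 eps^2, and with k = 3, where (24/eps) (eps/4)^3 <=
    eps^2. *)
Let rate (k : nat) (c s : R) : c = k%:R / 2 -> c * trel P * ln (4 / eps) <= s ->
  expR (- (2 * s / trel P)) <= (eps / 4) ^+ k.
Proof.
move=> cE h; apply: expR_rate_bound; first by rewrite divr_gt0.
have -> : 1 / (eps / 4) = 4 / eps by field; rewrite gt_eqF.
rewrite ler_pdivlMr//; move: h; rewrite cE; lra.
Qed.

(* With [m2] the square of the threshold factor of the maximal inequality, the
   good set has mass at least [1 - 6 / m2]: 12 gives 1/2, and [24 / eps] gives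
   [1 - eps / 4]. *)
Let mixture_a (s : R) : trel P * ln (4 / eps) <= s ->
  mixture_le (12 * expR (- (2 * s / trel P))) (eps / 2) eps.
Proof.
move=> h; apply: mixture_le_half => //.
have one : 1 = 2 / 2 :> R by field.
have := @rate 2 1 s one; rewrite mul1r => /(_ h) hr; apply: le_trans (ler_wpM2l _ hr) _ => //.
have := sqr_ge0 eps; lra.
Qed.

Let mixture_b (s : R) : trel P <= s ->
  mixture_le (12 * expR (- (2 * s / trel P))) (1 - 2 * eps) (1 - eps).
Proof.
move=> h; apply: mixture_le_large => //.
have : expR (- (2 * s / trel P)) <= expR (- 2).
  by rewrite ler_expR lerN2 ler_pdivlMr// ler_pM2l.
have := @expR2_ge R; rewrite (expRN 2) => e2 h1.
have : (expR 2)^-1 <= 3 / 16 :> R.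
  rewrite -(ler_pM2l (expR_gt0 2)) mulfV ?gt_eqF ?expR_gt0//; lra.
lra.
Qed.

Let mixture_c (s : R) : 3 * trel P / 2 * ln (4 / eps) <= s ->
  mixture_le (24 / eps * expR (- (2 * s / trel P))) (3 * eps / 4) eps.
Proof.
move=> h; apply: mixture_le_quarter => //.
have := @rate 3 (3 / 2) s erefl.
have -> : 3 / 2 * trel P = 3 * trel P / 2 by ring.
move=> /(_ h) hr; apply: le_trans (ler_wpM2l _ hr) _; first by rewrite divr_ge0// ltW.
have -> : 24 / eps * (eps / 4) ^+ 3 = 24 / 64 * eps ^+ 2 by field; rewrite gt_eqF.
have := sqr_ge0 eps; lra.
Qed.

Let six_c : 6 / (24 / eps) <= 1 - (1 - eps / 4).
Proof.
have -> : 6 / (24 / eps) = eps / 4 by field; rewrite gt_eqF.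
lra.
Qed.

Let m2c : 0 < 24 / eps. Proof. by rewrite divr_gt0. Qed.

Let lbound_nat (p : nat -> Prop) : has_lbound [set (t%:R : R) | t in [set t : nat | p t]].
Proof. by exists 0 => _ [t _ <-]. Qed.

Let lbound_ct (p : R -> Prop) : has_lbound [set t : R | 0 <= t /\ p t].
Proof. by exists 0 => t []. Qed.

Let inf_nat_shift (p q : nat -> Prop) (k : nat) : (exists t, p t) ->
  (forall t, p t -> q (t + k)%N) ->
  inf [set (t%:R : R) | t in [set t : nat | q t]] <=
  inf [set (t%:R : R) | t in [set t : nat | p t]] + k%:R.
Proof.
move=> [t pt] H; apply: inf_le_shift => //; first by exists t%:R; exists t.
by move=> _ [u pu <-]; exists (u + k)%N; [exact: H | rewrite natrD].
Qed.

Lemma discrete_bounds (d : measure_display) (T : measurableType d)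
    (Pr : 'I_n -> probability T R) (X : nat -> T -> 'I_n) :
  markov_chain P Pr X ->
    [/\ hit pi Pr X (1 / 2) (3 * eps / 2) - ceilr (2 * trel P * `|ln eps|)
          <= tmix P pi eps
          <= hit pi Pr X (1 / 2) (eps / 2) + ceilr (trel P * ln (4 / eps)),
        hit pi Pr X (1 / 2) (1 - eps / 2) - ceilr (2 * trel P * `|ln eps|)
          <= tmix P pi (1 - eps)
          <= hit pi Pr X (1 / 2) (1 - 2 * eps) + ceilr (trel P) &
        Num.max (hit pi Pr X (1 - eps / 4) (5 * eps / 4))
                ((trel P - 1) * `|ln (2 * eps)|)
          <= tmix P pi eps
          <= hit pi Pr X (1 - eps / 4) (3 * eps / 4)
             + ceilr (3 * trel P / 2 * ln (4 / eps))].
Proof.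
move=> mc; move: (eps_gt0) (eps_le) => eps_pos eps_quarter.
have e1 : eps <= 1 by lra.
have mix_ex r : 0 < r -> exists t, dist_mix P pi t <= r.
  by move=> r0; have [t []] := exists_dist_mix_le n_ge2 sP statP iP rP lP r0; exists t.
have low r t s e : 0 <= r -> 0 < e -> e <= 1 -> 2 * trel P * `|ln e| <= s%:R ->
    dist_mix P pi t <= r -> p_hit pi Pr X (1 / 2) (t + s) <= r + e / 2.
  move=> r0 e0 el Hs Ht; apply/(p_hit_leP _ _ _ mc) => [|x A HA].
    by rewrite addr_ge0// divr_ge0// ltW.
  exact: (avoid_le_of_dist_mix n_ge2 sP statP iP rP lP).
(* Mixing to level p/2 and then waiting brings the avoidance probability below p; [e] is p capped at
   1, as [low] demands. *)
have hit_ex al p : 1 / 2 <= al -> 0 < p -> exists t, p_hit pi Pr X al t <= p.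
  move=> Hal p0; pose e := Num.min p 1.
  have e_gt0 : 0 < e by rewrite lt_min p0 ltr01.
  have [t Ht] := mix_ex (p / 2) (divr_gt0 p0 (ltr0n _ 2)).
  have s0 : 0 <= 2 * trel P * `|ln e| by rewrite !mulr_ge0// ltW.
  have [s _ Hs] := ceilr_nat s0; exists (t + s)%N.
  have ep : e <= p by rewrite ge_min lexx.
  have el : e <= 1 by rewrite ge_min lexx orbT.
  have p20 : 0 <= p / 2 by lra.
  have := low _ _ _ _ p20 e_gt0 el Hs Ht.
  have q0 : 0 <= p / 2 + e / 2 by lra.
  move=> /(p_hit_leP _ _ _ mc q0) H; apply/(p_hit_leP _ _ _ mc (ltW p0)) => x A HA.
  by apply: le_trans (H x A (le_trans Hal HA)) _; lra.
have up al m2 p r k : 0 <= r -> 0 <= p -> 0 < m2 -> 6 / m2 <= 1 - al ->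
    mixture_le (m2 * expR (- (2 * k%:R / trel P))) p r ->
    forall t, p_hit pi Pr X al t <= p -> dist_mix P pi (t + k) <= r.
  move=> r0 p0 m20 Hm Hmix t /(p_hit_leP _ _ _ mc p0) H.
  exact: (dist_mix_le_of_avoid n_ge2 sP statP iP rP lP r0 m20 Hm H Hmix).
(* Only the position at time t is used: the complement of A has mass at most eps/4, and mixing adds
   eps. *)
have low_c t : dist_mix P pi t <= eps -> p_hit pi Pr X (1 - eps / 4) t <= 5 * eps / 4.
  move=> /(dist_mix_leP _ _ _ (ltW eps_gt0)) H; apply/(p_hit_leP _ _ _ mc) => [|x A HA].
    by lra.
  have := avoid_add_le A t 0 x sP; rewrite addn0 => /le_trans; apply.
  rewrite -mean_row.
  apply: le_trans (tv_dist_test (nu := pi) _ _ _) _ => //.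
  - exact: stochasticX.
  - by move=> y; exact: avoid_bound.
  have := H x; rewrite /= mean_indic mass_setC//; lra.
have ls0 : 0 <= 2 * trel P * `|ln eps| by rewrite !mulr_ge0// ltW.
have [sl slE Hsl] := ceilr_nat ls0.
have [sa saE Hsa] := ceilr_nat (mulr_ge0 (ltW trel0) ln4e0).
have [sb sbE Hsb] := ceilr_nat (ltW trel0).
have c0 : 0 <= 3 * trel P / 2 * ln (4 / eps).
  by rewrite mulr_ge0// divr_ge0// mulr_ge0// ltW.
have [sc scE Hsc] := ceilr_nat c0.
have half : 6 / 12 <= 1 - 1 / 2 :> R by lra.
rewrite slE saE sbE scE !lerBlDr; split.
- apply/andP; split; apply: inf_nat_shift.
  + exact: mix_ex.
  + move=> t Ht; have -> : 3 * eps / 2 = eps + eps / 2 by field.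
    by apply: low => //; lra.
  + by apply: hit_ex => //; lra.
  + by apply: (up _ 12) => //; [lra | lra | exact: mixture_a].
- apply/andP; split; apply: inf_nat_shift.
  + by apply: mix_ex; lra.
  + move=> t Ht; have -> : 1 - eps / 2 = 1 - eps + eps / 2 by field.
    by apply: low => //; lra.
  + by apply: hit_ex => //; lra.
  + by apply: (up _ 12) => //; [lra | lra | exact: mixture_b].
- apply/andP; split; last first.
    apply: inf_nat_shift; first by apply: hit_ex; lra.
    by apply: (up _ (24 / eps)) => //; [lra | lra | exact: mixture_c].
  rewrite ge_max; apply/andP; split.
    rewrite -[X in _ <= X]addr0; apply: (inf_nat_shift (k := 0)); first exact: mix_ex.
    by move=> t Ht; rewrite addn0; exact: low_c.
  apply: lb_le_inf; first by have [t Ht] := mix_ex _ eps_gt0; exists t%:R; exists t.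
  by move=> _ [t Ht <-]; exact: (dist_mix_trel n_ge2 sP statP iP rP lP).
Qed.

Lemma continuous_bounds (d : measure_display) (T : measurableType d)
    (Pr : 'I_n -> probability T R) (X : R -> T -> 'I_n) :
  markov_chain_ct P Pr X ->
    [/\ hit_ct pi Pr X (1 / 2) (3 * eps / 2) - 2 * trel P * `|ln eps|
          <= tmix_ct P pi eps
          <= hit_ct pi Pr X (1 / 2) (eps / 2) + trel P * ln (4 / eps),
        hit_ct pi Pr X (1 / 2) (1 - eps / 2) - 2 * trel P * `|ln eps|
          <= tmix_ct P pi (1 - eps)
          <= hit_ct pi Pr X (1 / 2) (1 - 2 * eps) + trel P &
        Num.max (hit_ct pi Pr X (1 - eps / 4) (5 * eps / 4))
                ((trel P - 1) * `|ln (2 * eps)|)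
          <= tmix_ct P pi eps
          <= hit_ct pi Pr X (1 - eps / 4) (3 * eps / 4)
             + 3 * trel P / 2 * ln (4 / eps)].
Proof.
move=> mc; move: (eps_gt0) (eps_le) => eps_pos eps_quarter.
have e1 : eps <= 1 by lra.
have mix_ex r : 0 < r -> exists t : R, 0 <= t /\ dist_mix_ct P pi t <= r.
  by move=> r0; have [t []] := exists_dist_mix_le n_ge2 sP statP iP rP lP r0; exists t%:R.
have ls0 e : 0 <= 2 * trel P * `|ln e| by rewrite !mulr_ge0// ltW.
have low r t e : 0 <= r -> 0 < e -> e <= 1 -> 0 <= t ->
    dist_mix_ct P pi t <= r ->
    forall x, p_hit_ct pi Pr X x (1 / 2) (t + 2 * trel P * `|ln e|) <= r + e / 2.
  move=> r0 e0 el t0 Ht x; apply/p_hit_ct_leP => [|A HA].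
    by rewrite addr_ge0// divr_ge0// ltW.
  exact: (hit_prob_le_of_dist_mix n_ge2 sP statP iP rP lP mc).
have hit_ex al p : 1 / 2 <= al -> 0 < p ->
    exists t : R, 0 <= t /\ forall x, p_hit_ct pi Pr X x al t <= p.
  move=> Hal p0; pose e := Num.min p 1.
  have e_gt0 : 0 < e by rewrite lt_min p0 ltr01.
  have [t [t0 Ht]] := mix_ex (p / 2) (divr_gt0 p0 (ltr0n _ 2)).
  exists (t + 2 * trel P * `|ln e|); split; first by rewrite addr_ge0.
  have ep : e <= p by rewrite ge_min lexx.
  have el : e <= 1 by rewrite ge_min lexx orbT.
  have p20 : 0 <= p / 2 by lra.
  have := low _ _ _ p20 e_gt0 el t0 Ht => H x.
  have q0 : 0 <= p / 2 + e / 2 by lra.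
  have {}H := (p_hit_ct_leP _ _ _ _ _ _ q0).1 (H x).
  apply/(p_hit_ct_leP _ _ _ _ _ _ (ltW p0)) => A HA.
  by apply: le_trans (H A (le_trans Hal HA)) _; lra.
have up al m2 p r s : 0 <= r -> 0 <= p -> 0 <= s -> 0 < m2 -> 6 / m2 <= 1 - al ->
    mixture_le (m2 * expR (- (2 * s / trel P))) p r ->
    forall t : R, 0 <= t /\ (forall x, p_hit_ct pi Pr X x al t <= p) ->
    0 <= t + s /\ dist_mix_ct P pi (t + s) <= r.
  move=> r0 p0 s0 m20 Hm Hmix t [t0 H]; split; first by rewrite addr_ge0.
  exact: (dist_mix_ct_le_of_hit n_ge2 sP statP iP rP lP mc r0 p0 t0 s0 m20 Hm H Hmix).
have low_c t : 0 <= t -> dist_mix_ct P pi t <= eps ->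
    forall x, p_hit_ct pi Pr X x (1 - eps / 4) t <= 5 * eps / 4.
  move=> t0 /(dist_mix_ct_leP _ _ _ (ltW eps_gt0)) H x; apply/p_hit_ct_leP => [|A HA].
    by lra.
  (* A grid of length 0 with one step observes time t alone. *)
  have := hit_prob_le_grid mc x A t0 (lexx 0) (ltn0Sn 0).
  rewrite addr0 => /le_trans; apply; rewrite -mean_row.
  have s00 : stochastic (heat_kernel P (0 / 1)).
    by rewrite mul0r; exact: (heat_stochastic sP statP iP rP).
  apply: le_trans (tv_dist_test (nu := pi) _ _ _) _ => //.
  - exact: (heat_stochastic sP statP iP rP).
  - by move=> y; exact: avoid_bound.
  apply: (@le_trans _ _ (mean pi (indic (~: A)) + eps)).
    apply: lerD => //; apply: ler_sum => y _; rewrite ler_wpM2l//; first by case: dpi.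
    rewrite [X in _ <= X]mxE inE; case: (boolP (y \in A)) => yA.
      by rewrite avoid_in.
    by case/andP: (avoid_bound A 1 y s00).
  by rewrite mean_indic mass_setC//; lra.
have c0 : 0 <= 3 * trel P / 2 * ln (4 / eps).
  by rewrite mulr_ge0// divr_ge0// mulr_ge0// ltW.
have a0 : 0 <= trel P * ln (4 / eps) by rewrite mulr_ge0// ltW.
have half : 6 / 12 <= 1 - 1 / 2 :> R by lra.
rewrite !lerBlDr; split.
- apply/andP; split; apply: inf_le_shift => //.
  + exact: mix_ex.
  + move=> t [t0 Ht]; split; first by rewrite addr_ge0.
    have -> : 3 * eps / 2 = eps + eps / 2 by field.
    by apply: low => //; lra.
  + by apply: hit_ex => //; lra.
  + by apply: (up _ 12) => //; [lra | lra | exact: mixture_a].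
- apply/andP; split; apply: inf_le_shift => //.
  + by apply: mix_ex; lra.
  + move=> t [t0 Ht]; split; first by rewrite addr_ge0.
    have -> : 1 - eps / 2 = 1 - eps + eps / 2 by field.
    by apply: low => //; lra.
  + by apply: hit_ex => //; lra.
  + by apply: (up _ 12) => //; [lra | lra | exact: ltW | exact: mixture_b].
- apply/andP; split; last first.
    apply: inf_le_shift => //; first by apply: hit_ex; lra.
    by apply: (up _ (24 / eps)) => //; [lra | lra | exact: mixture_c].
  rewrite ge_max; apply/andP; split.
    rewrite -[X in _ <= X]addr0; apply: inf_le_shift => //; first exact: mix_ex.
    by move=> t [t0 Ht]; rewrite addr0; split => //; exact: low_c.
  apply: lb_le_inf; first exact: mix_ex.
  by move=> t [t0 Ht]; exact: (dist_mix_ct_trel n_ge2 sP statP iP rP lP).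
Qed.

End Bounds.

Theorem proposition1p7 (R : realType) (n : nat) (P : 'M[R]_n) (pi : 'rV[R]_n)
    (eps : R)
    (n_ge2 : (2 <= n)%N)
    (P_stochastic : stochastic P)
    (pi_stationary : stationary P pi)
    (P_irreducible : irreducible P)
    (P_reversible : reversible P pi)
    (P_lazy : lazy P)
    (eps_gt0 : 0 < eps)
    (eps_le : eps <= 4^-1) :
  (forall (d : measure_display) (T : measurableType d)
      (Pr : 'I_n -> probability T R) (X : nat -> T -> 'I_n),
    markov_chain P Pr X ->
    [/\ hit pi Pr X (1 / 2) (3 * eps / 2) - ceilr (2 * trel P * `|ln eps|)
          <= tmix P pi eps
          <= hit pi Pr X (1 / 2) (eps / 2) + ceilr (trel P * ln (4 / eps)),
        hit pi Pr X (1 / 2) (1 - eps / 2) - ceilr (2 * trel P * `|ln eps|)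
          <= tmix P pi (1 - eps)
          <= hit pi Pr X (1 / 2) (1 - 2 * eps) + ceilr (trel P) &
        Num.max (hit pi Pr X (1 - eps / 4) (5 * eps / 4))
                ((trel P - 1) * `|ln (2 * eps)|)
          <= tmix P pi eps
          <= hit pi Pr X (1 - eps / 4) (3 * eps / 4)
             + ceilr (3 * trel P / 2 * ln (4 / eps))]) /\
  (forall (d : measure_display) (T : measurableType d)
      (Pr : 'I_n -> probability T R) (X : R -> T -> 'I_n),
    markov_chain_ct P Pr X ->
    [/\ hit_ct pi Pr X (1 / 2) (3 * eps / 2) - 2 * trel P * `|ln eps|
          <= tmix_ct P pi eps
          <= hit_ct pi Pr X (1 / 2) (eps / 2) + trel P * ln (4 / eps),
        hit_ct pi Pr X (1 / 2) (1 - eps / 2) - 2 * trel P * `|ln eps|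
          <= tmix_ct P pi (1 - eps)
          <= hit_ct pi Pr X (1 / 2) (1 - 2 * eps) + trel P &
        Num.max (hit_ct pi Pr X (1 - eps / 4) (5 * eps / 4))
                ((trel P - 1) * `|ln (2 * eps)|)
          <= tmix_ct P pi eps
          <= hit_ct pi Pr X (1 - eps / 4) (3 * eps / 4)
             + 3 * trel P / 2 * ln (4 / eps)]).
Proof.
split=> d T Pr X.
  exact: (discrete_bounds n_ge2 P_stochastic pi_stationary P_irreducible
    P_reversible P_lazy eps_gt0 eps_le).
exact: (continuous_bounds n_ge2 P_stochastic pi_stationary P_irreducible
  P_reversible P_lazy eps_gt0 eps_le).
Qed.
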